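(* Let $X$ be a non-degenerate $d$-variate random vector with $M_X(t)=\mathbb{E}[\exp(t^\top X)]<\infty$ for each $t\in\mathbb{R}^d$, and assume $\mathbb{E}X=0$. Put $R_X(t)=\mathrm{Re}\,\varphi_X(t)$, where $\varphi_X(t)=\mathbb{E}[\exp(\mathrm{i}t^\top X)]$, $t\in\mathbb{R}^d$. Then $$R_X(t)\,M_X(t)-1=0\quad\text{for each }t\in\mathbb{R}^d$$ holds if, and only if, $X$ follows a zero-mean normal distribution.
   Context: $\varphi_X$ is the characteristic function and $M_X$ the moment generating function of $X$; $\mathrm{Re}$ denotes the real part and $\mathrm{i}$ the imaginary unit. Vectors are column vectors. *)

(* Defs.v *)
From HB Require Import structures.
From mathcomp Require Import all_boot all_order all_algebra.
From mathcomp Require Import complex.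
From mathcomp Require Import all_classical all_reals all_analysis.

Set Implicit Arguments.
Unset Strict Implicit.
Unset Printing Implicit Defensive.

Import Order.TTheory GRing.Theory Num.Theory.
Import numFieldNormedType.Exports.

Local Open Scope classical_set_scope.
Local Open Scope ring_scope.
Local Open Scope complex_scope.

Definition dotv (R : realType) (d : nat) (t x : 'cV[R]_d) : R :=
  (t^T *m x) 0 0.

(* The Borel sigma-algebra of R^d is generated by the coordinates. *)
Definition random_vector (R : realType) (disp : measure_display)
    (T : measurableType disp) (d : nat) (X : T -> 'cV[R]_d) : Prop :=
  forall i : 'I_d, measurable_fun [set: T] (fun w => X w i 0).

Definition nondegenerate_rv (R : realType) (disp : measure_display)
    (T : measurableType disp) (P : probability T R) (d : nat)
    (X : T -> 'cV[R]_d) : Prop :=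
  ~ exists c : 'cV[R]_d, {ae P, forall w, X w = c}.

Definition mgf (R : realType) (disp : measure_display)
    (T : measurableType disp) (P : probability T R) (d : nat)
    (X : T -> 'cV[R]_d) (t : 'cV[R]_d) : \bar R :=
  'E_P[fun w => expR (dotv t (X w))].

Definition expi (R : realType) (y : R) : R[i] := cos y +i* sin y.

(* Meaningful when the real and imaginary parts are integrable: otherwise
   [fine] may truncate an infinite expectation to 0. *)
Definition expectationC (R : realType) (disp : measure_display)
    (T : measurableType disp) (P : probability T R) (Z : T -> R[i]) : R[i] :=
  fine ('E_P[fun w => complex.Re (Z w)]) +i*
  fine ('E_P[fun w => complex.Im (Z w)]).

Definition char_fun (R : realType) (disp : measure_display)
    (T : measurableType disp) (P : probability T R) (d : nat)
    (X : T -> 'cV[R]_d) (t : 'cV[R]_d) : R[i] :=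
  expectationC P (fun w => expi (dotv t (X w))).

(* N(m, v) with variance v; [normal_prob] takes the standard deviation and is
   not the normal law when the latter is 0, whence the Dirac case. *)
Definition normal_law (R : realType) (m v : R) : set R -> \bar R :=
  if v == 0 then dirac m else normal_prob m (Num.sqrt v).

(* X ~ N_d(mu, S), S possibly singular: every linear combination a^T X of the
   coordinates has the univariate law N(a^T mu, a^T S a). *)
Definition mvnormal (R : realType) (disp : measure_display)
    (T : measurableType disp) (P : probability T R) (d : nat)
    (X : T -> 'cV[R]_d) (mu : 'cV[R]_d) (S : 'M[R]_d) : Prop :=
  [/\ S^T = S,
      forall a : 'cV[R]_d, 0 <= dotv a (S *m a)
    & forall (a : 'cV[R]_d) (A : set R), measurable A ->
        pushforward P (fun w => dotv a (X w)) A =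
        normal_law (dotv a mu) (dotv a (S *m a)) A].

(* Main.v *)
Require Import Defs.
From HB Require Import structures.
From mathcomp Require Import all_boot all_order all_algebra.
From mathcomp Require Import complex.
From mathcomp Require Import all_classical all_reals all_analysis.
From mathcomp Require Import measurable_realfun ring lra zify.

Set Implicit Arguments.
Unset Strict Implicit.
Unset Printing Implicit Defensive.

Import Order.TTheory GRing.Theory Num.Theory.
Import numFieldNormedType.Exports.

Local Open Scope classical_set_scope.
Local Open Scope ring_scope.

(** Fix a direction [a] and let [Y = a^T X], [M(t) = E exp(tY)].  The identity
    [E cos(tY) * M(t) = 1] makes [M] even, say [M(t) = A(t^2)], and says
    [A(w) A(-w) = 1] with [A] an entire power series.  Hence [A] has an entire
    logarithm [H(w) = sum_j h_j w^j] (its derivative has the coefficients of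
    [A'(w) A(-w)]) which is odd.  The ridge property
    [|M(x + iy)| <= M(x)] reads
    [Re H(rho e^(i phi)) <= H(rho (1 + cos phi) / 2)], and oddness turns it into
    a lower bound as well.  Averaging [Re H] over a circle against
    [m cos phi -+ cos (m phi)] gives, with [G(w) = sum_j |h_j| w^j],
    [|h_m| rho^m <= m (|h_1| rho + G(rho / 2))] for odd [m].  Since the sum of
    [m / 2^m] over odd [m >= 3] is [11/18 < 1], summation yields
    [G(w) <= C w], so [H] is linear and [M(t) = exp(h_1 t^2)].  This replaces the
    Hadamard and Marcinkiewicz theorems.

    The law of [Y] is then identified by its characteristic function: bounded
    pointwise limits of trigonometric polynomials include the sign of
    [sin((y - b) / n)], hence the sign of [y - b]. *)

(** * Entire power series *)

Section CauchyProduct.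
Variable R : realType.
Implicit Types (u v a b : R^nat) (x : R).

Definition conv u v : R^nat := fun n => \sum_(i < n.+1) u i * v (n - i)%N.

Lemma series_conv u v n :
  series (conv u v) n = \sum_(i < n) u i * series v (n - i)%N.
Proof.
elim: n => [|n IHn]; first by rewrite /series/= big_geq// big_ord0.
rewrite seriesSr IHn [RHS]big_ord_recr/= subSnn.
rewrite [in RHS](eq_bigr (fun i : 'I_n =>
    u i * series v (n - i)%N + u i * v (n - i)%N)); last first.
  by move=> i _; rewrite subSn ?(ltnW (ltn_ord i))// seriesSr mulrDr.
rewrite big_split/= -addrA; congr (_ + _).
by rewrite /conv big_ord_recr/= subnn /series/= big_nat1.
Qed.

Lemma ler_series_nneg u m n : (forall k, 0 <= u k) -> (m <= n)%N ->
  series u m <= series u n.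
Proof.
move=> u0 mn; have : nondecreasing_seq (series u).
  by apply: nondecreasing_series => k _ _; exact: u0.
exact.
Qed.

Lemma series_ge0 u n : (forall k, 0 <= u k) -> 0 <= series u n.
Proof. by move=> u0; rewrite sumr_ge0. Qed.

Lemma norm_series_sub v m n : (m <= n)%N ->
  `|series v n - series v m| <=
  series (fun k => `|v k|) n - series (fun k => `|v k|) m.
Proof. by move=> mn; rewrite !sub_series_geq// ler_norm_sum. Qed.

(** By [series_conv] the error is the sum of [u i] times a block of the series of [v]. Termwise
    absolute values give the same expression for [|u|] and [|v|], so nonnegative series suffice. *)
Lemma cauchy_product_error u v n :
  `|series u n * series v n - series (conv u v) n| <=
  series (fun k => `|u k|) n * series (fun k => `|v k|) n -
  series (conv (fun k => `|u k|) (fun k => `|v k|)) n.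
Proof.
have E (w : R^nat) : series w n = \sum_(i < n) w i by rewrite /series/= big_mkord.
rewrite !series_conv (E u) (E (fun k => `|u k|)) !mulr_suml -!sumrB.
apply: le_trans (ler_norm_sum _ _ _) _; apply: ler_sum => i _.
by rewrite -!mulrBr normrM ler_wpM2l// norm_series_sub// leq_subr.
Qed.

(** The square of indices below [n / 2] lies inside the triangle [i + j < n]. *)
Lemma cauchy_product_half u v n : (forall k, 0 <= u k) -> (forall k, 0 <= v k) ->
  series u n./2 * series v n./2 <= series (conv u v) n.
Proof.
move=> u0 v0; rewrite series_conv {1}/series/= big_mkord mulr_suml.
have hn : (n./2 <= n)%N by have := odd_double_half n; lia.
rewrite [leRHS](_ : _ = \sum_(0 <= i < n) u i * series v (n - i)%N); last first.
  by rewrite big_mkord.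
rewrite (big_cat_nat (n := n./2))//= big_mkord -[leLHS]addr0 lerD//.
  apply: ler_sum => i _; rewrite ler_wpM2l// ler_series_nneg//.
  have := ltn_ord i; have := odd_double_half n; lia.
by rewrite sumr_ge0// => i _; rewrite mulr_ge0// series_ge0.
Qed.

Lemma is_cvg_series_shiftS u :
  cvgn (series (fun n => u n.+1)) <-> cvgn (series u).
Proof.
have E : (fun n => series u n.+1) = (fun n => u 0%N + series (fun k => u k.+1) n).
  by apply/funext => n; rewrite /series/= big_nat_recl.
split=> /cvg_ex[l cl]; apply/cvg_ex.
  exists (u 0%N + l); rewrite -(cvg_shiftS (series u)) E.
  by apply: cvgD => //; exact: cvg_cst.
exists (l - u 0%N); move: cl; rewrite -(cvg_shiftS (series u)) E => cl.
rewrite (_ : series _ = fun n => u 0%N + series (fun k => u k.+1) n - u 0%N).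
  by apply: cvgB => //; exact: cvg_cst.
by apply/funext => n; rewrite addrAC subrr add0r.
Qed.

Lemma cvg_half (T : topologicalType) (f : nat -> T) (l : T) :
  f n @[n --> \oo] --> l -> f n./2 @[n --> \oo] --> l.
Proof.
move=> fl; apply: (cvg_comp (fun n => n./2) f _ fl) => A [N _ NA].
by exists N.*2 => // n /= Nn; apply: NA => /=; rewrite -(doubleK N) half_leq.
Qed.

(** The two preceding bounds squeeze the error between 0 and [U n V n - U (n / 2) V (n / 2)], a
    difference of sequences with the same limit. *)
Lemma cvg_cauchy_product u v :
  cvgn [normed series u] -> cvgn [normed series v] ->
  series (conv u v) @ \oo --> limn (series u) * limn (series v).
Proof.
move=> nu nv.
have cu := normed_cvg nu; have cv := normed_cvg nv.
have cuv : series u n * series v n @[n --> \oo] -->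
  limn (series u) * limn (series v) by exact: cvgM.
apply: cvg_sub0 cuv.
pose U := series (fun k => `|u k|); pose V := series (fun k => `|v k|).
have UV : U n * V n @[n --> \oo] --> limn U * limn V by exact: cvgM.
have e0 : (U n * V n - U n./2 * V n./2) @[n --> \oo] --> (0 : R).
  rewrite -(subrr (limn U * limn V)); apply: cvgB => //.
  exact: (cvg_half UV).
apply: norm_cvg0; apply: (@squeeze_cvgr _ _ _ _ (cst 0)
  (fun n => U n * V n - U n./2 * V n./2)) => //; last exact: cvg_cst.
apply: nearW => n /=; rewrite normr_ge0/= distrC.
apply: le_trans (cauchy_product_error _ _ _) _.
by rewrite lerB// cauchy_product_half.
Qed.

End CauchyProduct.

Section EntireSeries.
Variable R : realType.
Implicit Types (a b c : R^nat) (x r phi : R).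

Definition entire a := forall x, cvgn (pseries a x).

Definition psum a x : R := limn (pseries a x).

Lemma entire_norm a : entire a -> entire (fun n => `|a n|).
Proof.
move=> ea x; apply: (@is_cvg_pseries_inside_norm _ _ (`|x| + 1)) => //.
by rewrite [ltRHS]ger0_norm ?addr_ge0// ltrDl.
Qed.

Lemma entire_normed a x : entire a -> cvgn [normed series (fun n => a n * x ^+ n)].
Proof.
move=> /entire_norm/(_ `|x|); rewrite /pseries.
rewrite (_ : (fun n => _ * _) = (fun n => `|a n * x ^+ n|))//.
by apply/funext => n; rewrite normrM normrX.
Qed.

Lemma entire_le a b : (forall n, `|a n| <= `|b n|) -> entire b -> entire a.
Proof.
move=> ab eb x; apply: normed_cvg.
apply: (@series_le_cvg _ _ (fun n => `|b n * x ^+ n|)) => [n|n|n|] //=.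
- by rewrite !normrM ler_wpM2r.
- exact: entire_normed.
Qed.

Lemma cvg_psum a x : entire a -> pseries a x @ \oo --> psum a x.
Proof. by move=> ea; exact: ea. Qed.

Lemma entireD a b : entire a -> entire b -> entire (fun n => a n + b n).
Proof.
move=> ea eb x; rewrite /pseries.
rewrite (_ : (fun n => _) = (fun n => a n * x ^+ n) + (fun n => b n * x ^+ n)).
  by apply: is_cvg_seriesD; [exact: ea|exact: eb].
by apply/funext => n /=; rewrite mulrDl.
Qed.

Lemma entireZ k a : entire a -> entire (fun n => k * a n).
Proof.
move=> ea x; rewrite /pseries.
rewrite (_ : (fun n => _) = k *: (fun n => a n * x ^+ n)).
  by apply: is_cvg_seriesZ; exact: ea.
by apply/funext => n /=; rewrite -mulrA.
Qed.

Lemma entireB a b : entire a -> entire b -> entire (fun n => a n - b n).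
Proof.
move=> ea /(entireZ (k := -1)) eb; have := entireD ea eb.
by under eq_fun do rewrite mulN1r.
Qed.

Lemma psumD a b x : entire a -> entire b ->
  psum (fun n => a n + b n) x = psum a x + psum b x.
Proof.
move=> ea eb; rewrite -[RHS](lim_seriesD (ea x) (eb x)).
rewrite /psum /pseries; congr (limn (series _)).
by apply/funext => n /=; rewrite mulrDl.
Qed.

Lemma psumZ k a x : entire a -> psum (fun n => k * a n) x = k * psum a x.
Proof.
move=> ea; rewrite -[RHS](lim_seriesZ k (ea x)).
rewrite /psum /pseries; congr (limn (series _)).
by apply/funext => n /=; rewrite -mulrA.
Qed.

Lemma psumB a b x : entire a -> entire b ->
  psum (fun n => a n - b n) x = psum a x - psum b x.
Proof.
move=> ea eb; rewrite -mulN1r -(psumZ _ _ eb) -psumD//.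
  by congr (psum _ _); apply/funext => n; rewrite mulN1r.
exact: entireZ.
Qed.

Lemma ler_norm_psum a x : entire a -> `|psum a x| <= psum (fun n => `|a n|) `|x|.
Proof.
move=> ea; have := lim_series_norm (entire_normed (x := x) ea).
rewrite /psum /pseries.
rewrite (_ : (fun n => `|a n| * _) = (fun n => `|a n * x ^+ n|))//.
by apply/funext => n; rewrite normrM normrX.
Qed.

Lemma psum_at0 a : psum a 0 = a 0%N.
Proof.
apply: lim_near_cst => //; near=> n.
have -> : n = n.-1.+1 by rewrite prednK//; near: n; exact: nbhs_infty_gt.
rewrite /pseries /series/= big_nat_recl// expr0 mulr1 big1 ?addr0// => i _.
by rewrite expr0n mulr0.
Unshelve. all: by end_near. Qed.

Lemma entire_diffs a : entire a -> entire (pseries_diffs a).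
Proof.
move=> ea x; apply: normed_cvg.
(* Since [n + 1 <= 2 ^ n], the factor [(n + 1) |x| ^ n] is at most [(2 |x|) ^ n], hence at most
   [y ^ n.+1] because [y >= 1]. *)
pose y := 2 * `|x| + 1.
have y0 : 0 <= y by rewrite addr_ge0// mulr_ge0.
have cy : cvgn (series (fun n => `|a n.+1 * y ^+ n.+1|)).
  exact/(is_cvg_series_shiftS (fun n => `|a n * y ^+ n|))/entire_normed.
apply: series_le_cvg _ _ _ cy => n //=.
rewrite /pseries_diffs -mulrA mulrCA normrM [leRHS]normrM ler_wpM2l//.
rewrite normrM normr_nat (ger0_norm (exprn_ge0 _ y0)) normrX.
apply: (@le_trans _ _ (2 ^+ n * `|x| ^+ n)).
  by rewrite ler_wpM2r ?exprn_ge0// -natrX ler_nat ltn_expl.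
rewrite -exprMn; apply: (@le_trans _ _ (y ^+ n)).
  by rewrite lerXn2r ?nnegrE ?mulr_ge0// lerDl.
by rewrite exprSr ler_peMr ?exprn_ge0// lerDr mulr_ge0.
Qed.

Global Instance is_derive_psum a x : entire a ->
  is_derive x 1 (psum a) (psum (pseries_diffs a) x).
Proof.
move=> ea; apply: (@pseries_snd_diffs _ _ (`|x| + 1)).
- exact: ea.
- exact: entire_diffs.
- by do 2 apply: entire_diffs.
- by rewrite [ltRHS]ger0_norm ?addr_ge0// ltrDl.
Qed.

Lemma continuous_psum a : entire a -> continuous (psum a).
Proof.
move=> ee x; apply: differentiable_continuous; apply/derivable1_diffP.
by have [] := is_derive_psum x ee.
Qed.

(** The constant term is the limit at 0 along [1 / (n + 1)], and the derivative again vanishes on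
    the open half-line, so induction applies. Positive points are the ones available later, where
    the argument is a square [t ^ 2]. *)
Lemma psum_eq0 a : entire a -> (forall x, 0 < x -> psum a x = 0) ->
  forall n, a n = 0.
Proof.
move=> ea a0 n; elim: n a ea a0 => [|n IHn] a ea a0.
  have c1 : psum a n.+1%:R^-1 @[n --> \oo] --> psum a 0.
    by apply: (cvg_comp _ _ (@cvg_harmonic R)); exact: continuous_psum.
  have E : (fun n => psum a n.+1%:R^-1) = cst 0.
    by apply/funext => n; rewrite a0// invr_gt0.
  rewrite -psum_at0 -(cvg_lim _ c1)// E; exact: lim_cst.
have d0 x : 0 < x -> psum (pseries_diffs a) x = 0.
  move=> x0; have near0 : \near x, psum a x = cst 0 x.
    by near=> y; apply: a0; near: y; exact: lt_nbhsr.
  rewrite -(@derive_val _ _ _ _ _ _ _ (is_derive_psum x ea)).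
  by rewrite (near_eq_derive _ near0) derive_cst.
by have /eqP := IHn _ (entire_diffs ea) d0; rewrite mulf_eq0 pnatr_eq0 => /eqP.
Unshelve. all: by end_near. Qed.

Lemma psum_inj a b : entire a -> entire b ->
  (forall x, 0 < x -> psum a x = psum b x) -> a = b.
Proof.
move=> ea eb ab; apply/funext => n; apply/eqP; rewrite -subr_eq0; apply/eqP.
apply: (psum_eq0 (entireB ea eb)) => x x0.
by rewrite psumB// ab// subrr.
Qed.

Lemma convM a b x n :
  conv a b n * x ^+ n = conv (fun k => a k * x ^+ k) (fun k => b k * x ^+ k) n.
Proof.
rewrite /conv mulr_suml; apply: eq_bigr => i _.
by rewrite mulrACA -exprD subnKC// -ltnS.
Qed.

Lemma cvg_psum_conv a b x : entire a -> entire b ->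
  pseries (conv a b) x @ \oo --> psum a x * psum b x.
Proof.
move=> ea eb; rewrite /pseries.
rewrite (_ : (fun n => _) =
    conv (fun k => a k * x ^+ k) (fun k => b k * x ^+ k)); last first.
  by apply/funext => n; rewrite convM.
by apply: cvg_cauchy_product; exact: entire_normed.
Qed.

Lemma entire_conv a b : entire a -> entire b -> entire (conv a b).
Proof.
by move=> ea eb x; apply/cvg_ex; exists (psum a x * psum b x);
  exact: cvg_psum_conv.
Qed.

Lemma psum_conv a b x : entire a -> entire b ->
  psum (conv a b) x = psum a x * psum b x.
Proof. by move=> ea eb; apply/cvg_lim => //; exact: cvg_psum_conv. Qed.

Lemma psum_dilate a k x :
  psum (fun n => a n * k ^+ n) x = psum a (k * x).
Proof.
rewrite /psum /pseries; congr (limn (series _)); apply/funext => n /=.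
by rewrite exprMn mulrA.
Qed.

Lemma entire_dilate a k :
  entire a -> entire (fun n => a n * k ^+ n).
Proof.
move=> ea x; have := ea (k * x); rewrite /pseries.
rewrite (_ : (fun n => a n * (k * x) ^+ n) = (fun n => a n * k ^+ n * x ^+ n))//.
by apply/funext => n; rewrite exprMn mulrA.
Qed.

(** For fixed [phi], [twc] and [tws] are the coefficients in [x] of the real and imaginary parts of
    [a(x e^(i phi))]. This keeps the complex analysis inside real power series. *)
Definition twc a phi : R^nat := fun n => a n * cos (n%:R * phi).
Definition tws a phi : R^nat := fun n => a n * sin (n%:R * phi).

Lemma entire_twc a phi : entire a -> entire (twc a phi).
Proof. by apply: entire_le => n; rewrite normrM ler_piMr// cos_max. Qed.

Lemma entire_tws a phi : entire a -> entire (tws a phi).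
Proof. by apply: entire_le => n; rewrite normrM ler_piMr// sin_max. Qed.

End EntireSeries.

(** * Logarithms of power series *)

Section FormalLogarithm.
Variable R : realType.
Implicit Types (u v w al : R^nat).

Definition delta1 : R^nat := fun n => (n == 0%N)%:R.

(** Each coefficient involves finitely many terms, so truncation to polynomials transfers
    commutativity and associativity from the polynomial ring. *)
Lemma conv_coef u v n N : (n < N)%N ->
  conv u v n = (\poly_(i < N) u i * \poly_(i < N) v i)`_n.
Proof.
move=> nN; rewrite coefM; apply: eq_bigr => i _.
by rewrite !coef_poly !ifT//; have := ltn_ord i; lia.
Qed.

Lemma convC u v : conv u v = conv v u.
Proof. by apply/funext => n; rewrite !(@conv_coef _ _ n n.+1)// mulrC. Qed.

Lemma convA u v w : conv u (conv v w) = conv (conv u v) w.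
Proof.
apply/funext => n; pose p s := \poly_(i < n.+1) (s i : R).
transitivity ((p u * (p v * p w))`_n).
  rewrite coefM; apply: eq_bigr => i _.
  rewrite -(@conv_coef v w _ n.+1) ?coef_poly ?ltn_ord//.
  by rewrite ltnS leq_subr.
rewrite mulrA coefM; apply: eq_bigr => i _.
rewrite -(@conv_coef u v _ n.+1)// [X in _ * X]coef_poly ifT//.
by rewrite ltnS leq_subr.
Qed.

Lemma conv1 u : conv u delta1 = u.
Proof.
apply/funext => n; rewrite /conv big_ord_recr/= subnn /delta1 eqxx mulr1.
rewrite big1 ?add0r// => i _.
by rewrite subn_eq0 leqNgt ltn_ord mulr0.
Qed.

Definition altn u : R^nat := fun n => (-1) ^+ n * u n.

(** The logarithmic derivative [al' / al] when [al(x) al(-x) = 1]: division becomes multiplication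
    by [al(-x)], so the result is entire as soon as [al] is. *)
Definition log_diffs al : R^nat := conv (pseries_diffs al) (altn al).

Definition log_coef al : R^nat :=
  fun n => if n is m.+1 then log_diffs al m / n%:R else 0.

Lemma log_coef_diffs al : pseries_diffs (log_coef al) = log_diffs al.
Proof. by apply/funext => n; rewrite /pseries_diffs /log_coef mulrC divfK. Qed.

Lemma log_diffs_conv al : conv al (altn al) = delta1 ->
  pseries_diffs al = conv (log_diffs al) al.
Proof. by move=> H; rewrite /log_diffs -convA (convC _ al) H conv1. Qed.

(* The coefficients of (al(x) al(-x))' vanish, and the two halves of the product
   rule contribute equally in odd degree. *)
Lemma log_diffs_odd al n : conv al (altn al) = delta1 -> odd n ->
  log_diffs al n = 0.
Proof.
move=> H on.
have : n.+1%:R * conv al (altn al) n.+1 = 0 by rewrite H /delta1 mulr0.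
have -> : n.+1%:R * conv al (altn al) n.+1 = log_diffs al n + log_diffs al n.
  rewrite /conv mulr_sumr.
  pose t (i j : nat) := j%:R * (al i * altn al (n.+1 - i)%N).
  rewrite (eq_bigr (fun i : 'I_n.+2 => t i i + t i (n.+1 - i)%N)) => [|i _].
    rewrite big_split/=; congr (_ + _).
      rewrite big_ord_recl {1}/t mul0r add0r; apply: eq_bigr => i _.
      by rewrite /t /= /bump/= add1n subSS mulrA.
    rewrite (reindex_inj rev_ord_inj)/= big_ord_recl.
    rewrite /t subn1/= subnn mul0r add0r; apply: eq_bigr => i _.
    have ile := ltn_ord i; rewrite /= /bump/= /pseries_diffs /altn.
    have -> : (n.+2 - (1 + i).+1 = n - i)%N by lia.
    have -> : (n.+1 - (n - i) = i.+1)%N by lia.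
    have -> : (-1) ^+ i.+1 = (-1) ^+ (n - i) :> R.
      rewrite -(signr_odd _ i.+1) -(signr_odd _ (n - i)); congr (_ ^+ nat_of_bool _).
      by rewrite oddB ?on//= -ltnS.
    ring.
  by rewrite /t -mulrDl -natrD subnKC// -ltnS.
by lra.
Qed.

Lemma log_coef_even al n : conv al (altn al) = delta1 -> ~~ odd n ->
  log_coef al n = 0.
Proof.
move=> H; case: n => //= n on; rewrite log_diffs_odd ?mul0r//.
by rewrite negbK in on.
Qed.

Lemma entire_altn al : entire al -> entire (altn al).
Proof.
by apply: entire_le => n; rewrite /altn normrM normrX normrN1 expr1n mul1r.
Qed.

Lemma entire_log_coef al : entire al -> entire (log_coef al).
Proof.
move=> ea.
have eb : entire (log_diffs al).
  by apply: entire_conv; [exact: entire_diffs|exact: entire_altn].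
move=> x; apply: normed_cvg.
have cb : cvgn (series (fun n => `|x| * `|log_diffs al n * x ^+ n|)).
  exact: (is_cvg_seriesZ (k := `|x|) (entire_normed (x := x) eb)).
apply/(is_cvg_series_shiftS (fun n => `|log_coef al n * x ^+ n|)).
apply: series_le_cvg _ _ _ cb => n //=.
rewrite exprS mulrCA [X in X <= _]normrM ler_wpM2l// !normrM ler_wpM2r//.
by rewrite ler_piMr// normfV invf_le1 ?normr_gt0// normr_nat ler1n.
Qed.

End FormalLogarithm.

(** * Modulus of the exponential of a power series *)

Section ExponentialModulus.
Variable R : realType.
Implicit Types (a c : R^nat) (x phi : R).

(** The real part of [d/dx a(z) = (d/dx c(z)) a(z)] along the ray [z = x e^(i phi)]; the addition
    formula for the cosine performs the complex multiplication. *)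
Lemma diffs_twc a c phi : pseries_diffs a = conv (pseries_diffs c) a ->
  pseries_diffs (twc a phi) =
  (fun n => conv (pseries_diffs (twc c phi)) (twc a phi) n -
            conv (pseries_diffs (tws c phi)) (tws a phi) n).
Proof.
move=> ac; apply/funext => n.
have := congr1 (fun u : R^nat => u n) ac; rewrite /pseries_diffs /twc => acn.
rewrite mulrA acn /conv mulr_suml -sumrB; apply: eq_bigr => i _.
have -> : n.+1%:R * phi = i.+1%:R * phi + (n - i)%:R * phi.
  by rewrite -mulrDl -natrD addSn subnKC// -ltnS.
by rewrite cosD /tws; ring.
Qed.

Lemma diffs_tws a c phi : pseries_diffs a = conv (pseries_diffs c) a ->
  pseries_diffs (tws a phi) =
  (fun n => conv (pseries_diffs (twc c phi)) (tws a phi) n +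
            conv (pseries_diffs (tws c phi)) (twc a phi) n).
Proof.
move=> ac; apply/funext => n.
have := congr1 (fun u : R^nat => u n) ac; rewrite /pseries_diffs /tws => acn.
rewrite mulrA acn /conv mulr_suml -big_split; apply: eq_bigr => i _ /=.
have -> : n.+1%:R * phi = i.+1%:R * phi + (n - i)%:R * phi.
  by rewrite -mulrDl -natrD addSn subnKC// -ltnS.
by rewrite sinD /twc; ring.
Qed.

(* With [a = exp c] as formal series this is |exp(c(z))|^2 = exp(2 Re c(z)) at
   [z = x e^(i phi)]. *)
Lemma psum_twc_tws_sqr a c x phi : entire a -> entire c ->
  a 0%N = 1 -> c 0%N = 0 -> pseries_diffs a = conv (pseries_diffs c) a ->
  psum (twc a phi) x ^+ 2 + psum (tws a phi) x ^+ 2 =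
  expR (2 * psum (twc c phi) x).
Proof.
move=> ea ec a0 c0 ac.
set P := psum (twc a phi); set Q := psum (tws a phi).
set U := psum (twc c phi).
have eP := entire_twc (phi := phi) ea; have eQ := entire_tws (phi := phi) ea.
have eU := entire_twc (phi := phi) ec; have eV := entire_tws (phi := phi) ec.
have dP (y : R) : is_derive y 1 P (psum (pseries_diffs (twc a phi)) y).
  exact: is_derive_psum.
have dQ (y : R) : is_derive y 1 Q (psum (pseries_diffs (tws a phi)) y).
  exact: is_derive_psum.
have dU (y : R) : is_derive y 1 U (psum (pseries_diffs (twc c phi)) y).
  exact: is_derive_psum.
pose E : R -> R := expR \o (- 2 \*: U).
have dE (y : R) : is_derive y 1 E (E y * (- 2 *: psum (pseries_diffs (twc c phi)) y)).
  exact: is_derive1_comp.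
(* With [V = psum (tws c phi)], [P' = U' P - V' Q] and [Q' = U' Q + V' P], so
   [(P^2 + Q^2)' = 2 U' (P^2 + Q^2)]. The factor [E = exp(-2 U)] cancels this growth and [F] is
   constant. *)
pose F : R -> R := (P ^+ 2 + Q ^+ 2) * E.
have dF (y : R) : is_derive y 1 F 0.
  apply: is_derive_eq.
  rewrite (diffs_twc _ ac) (diffs_tws _ ac).
  have eU' := entire_diffs eU; have eV' := entire_diffs eV.
  rewrite psumB ?psumD ?psum_conv//; try exact: entire_conv.
  rewrite -/P -/Q /GRing.scale/= !fctE /=; ring.
have : F x = F 0 by apply: is_derive_0_is_cst.
have -> : F 0 = 1.
  rewrite /F /E !fctE/= /P /Q /U !psum_at0 /twc /tws.
  by rewrite mul0r cos0 sin0 a0 c0 mul0r scaler0 expR0 !mulr1 mulr0 expr0n addr0 expr1n.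
rewrite /F /E !fctE/= => /(congr1 (fun z => z * expR (2 * U x))).
by rewrite -mulrA -expRD /GRing.scale/= mulNr addNr expR0 mulr1 mul1r.
Qed.

End ExponentialModulus.

(** * Rigidity of odd series with the ridge property *)

Section RootsOfUnityAverages.
Variable R : realType.
Implicit Types (x phi : R) (m n p q N : nat).

Definition angle N j : R := j%:R * (pi *+ 2 / N%:R).

(** With [y = p pi / N], multiplying by [2 sin y] makes the sum telescope, and its two ends agree by
    periodicity; [0 < p < N] ensures [sin y > 0]. *)
Lemma sum_cos_angle p N : (0 < p < N)%N ->
  \sum_(j < N) cos (p%:R * angle N j) = 0.
Proof.
move=> /andP[p0 pN]; have N0 : (0 < N)%N by exact: ltn_trans pN.
have N0R : (N%:R : R) != 0 by rewrite pnatr_eq0 -lt0n.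
pose y : R := p%:R * pi / N%:R.
have sy : 0 < sin y.
  apply: sin_gt0_pi; rewrite /y divr_gt0 ?mulr_gt0 ?ltr0n ?pi_gt0//=.
  by rewrite ltr_pdivrMr ?ltr0n// mulrC ltr_pM2l ?pi_gt0// ltr_nat.
pose f j : R := sin (j%:R * (y *+ 2) - y).
have E j : cos (p%:R * angle N j) *+ 2 * sin y = f j.+1 - f j.
  have -> : p%:R * angle N j = j%:R * (y *+ 2) by rewrite /angle /y; ring.
  have -> : f j.+1 = sin (j%:R * (y *+ 2) + y).
    by congr sin; rewrite -addn1 natrD; ring.
  rewrite /f sinD sinB; ring.
have : (\sum_(j < N) cos (p%:R * angle N j)) * (sin y *+ 2) = f N - f 0%N.
  rewrite -(telescope_sumr _ (leq0n N)) big_mkord mulr_suml.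
  by apply: eq_bigr => j _; rewrite -E; ring.
have -> : f N - f 0%N = 0.
  rewrite /f mul0r add0r; apply/eqP; rewrite subr_eq0; apply/eqP.
  have -> : N%:R * (y *+ 2) - y = - y + (pi *+ 2) *+ p.
    by rewrite -[(pi *+ 2) *+ p]mulr_natr /y; field.
  by rewrite (periodicn (@sinD2pi R)).
by move/eqP; rewrite mulf_eq0 => /orP[/eqP//|]; rewrite mulrn_eq0/= gt_eqF.
Qed.

(** Product-to-sum formula: [p + q < N] prevents aliasing, so only the difference frequency 0
    survives. With [q > 0] the sum frequency is never 0. *)
Lemma sum_cos_angle2 p q N : (0 < q)%N -> (p + q < N)%N ->
  \sum_(j < N) cos (p%:R * angle N j) * cos (q%:R * angle N j) =
  (p == q)%:R * (N%:R / 2).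
Proof.
move=> q0 pqN.
wlog pq : p q q0 pqN / (p <= q)%N => [W|].
  have [/(W _ _ q0 pqN)//|qp] := leqP p q.
  rewrite eq_sym -W//; [|lia|lia|lia].
  by apply: eq_bigr => j _; rewrite mulrC.
have E x : cos (p%:R * x) * cos (q%:R * x) =
    (cos ((p + q)%:R * x) + cos ((q - p)%:R * x)) / 2.
  by rewrite natrD natrB// (mulrBl x) cosB (mulrDl _ _ x) cosD; field.
rewrite (eq_bigr _ (fun (j : 'I_N) _ => E (angle N j))) -mulr_suml big_split/=.
rewrite sum_cos_angle ?add0r; last by rewrite pqN andbT; lia.
have [->|neq] := eqVneq p q.
  rewrite subnn mul1r; congr (_ / 2).
  under eq_bigr do rewrite mul0r cos0.
  by rewrite sumr_const card_ord.
by rewrite sum_cos_angle ?mul0r//; lia.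
Qed.

(** Induction in steps of two: adding [2 phi] to the angle costs at most
    [|sin (2 phi)| <= 2 |cos phi|]. *)
Lemma norm_cos_odd m phi : odd m -> `|cos (m%:R * phi)| <= m%:R * `|cos phi|.
Proof.
move=> om; have -> : m = m./2.*2.+1 by rewrite -[LHS]odd_double_half om.
elim: m./2 => [|k IHk]; first by rewrite !mul1r.
have kE : k.+1.*2.+1%:R = k.*2.+1%:R + 2 :> R by rewrite doubleS -addn2 natrD.
have -> : k.+1.*2.+1%:R * phi = k.*2.+1%:R * phi + phi *+ 2.
  by rewrite kE; ring.
rewrite cosD; apply: le_trans (ler_normB _ _) _.
rewrite kE mulrDl lerD//.
  rewrite normrM; apply: le_trans IHk.
  by rewrite ler_piMr// cos_max.
rewrite normrM; apply: (@le_trans _ _ `|sin (phi *+ 2)|).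
  by rewrite ler_piMl// sin_max.
rewrite sin_mulr2n normrMn mulr_natl lerMn2r normrM.
by rewrite ler_piMr// sin_max.
Qed.

End RootsOfUnityAverages.

(** * Coefficient bounds from the ridge property *)

Section RidgeRigidity.
Variable R : realType.
Variable h : R^nat.
Hypothesis entire_h : entire h.
Hypothesis h_even : forall n, ~~ odd n -> h n = 0.
Hypothesis ridge : forall rho phi : R, 0 <= rho ->
  psum (twc h phi) rho <= psum h (rho * ((1 + cos phi) / 2)).

Let u rho phi := psum (twc h phi) rho.
Let G w := psum (fun n => `|h n|) w.

Let entire_G : entire (fun n => `|h n|).
Proof. exact: entire_norm. Qed.

Lemma ridge_antiperiodic rho phi : u rho (phi + pi) = - u rho phi.
Proof.
rewrite /u -mulN1r -psumZ; last exact: entire_twc.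
congr (psum _ _); apply/funext => n; rewrite /twc.
have [on|/h_even->] := boolP (odd n); last by rewrite !mul0r mulr0.
rewrite mulrDr [_ * pi]mulr_natl (alternatingn (@cosDpi R)) -signr_odd on expr1.
ring.
Qed.

Lemma majorant_ge0 w : 0 <= w -> 0 <= G w.
Proof.
move=> w0; apply: limr_ge; first exact: entire_G.
by apply: nearW => n; apply: series_ge0 => k; rewrite mulr_ge0 ?exprn_ge0.
Qed.

(** The constant term of [G] vanishes by [h_even], and [t ^ n <= t] for [n >= 1]. *)
Lemma majorant_scale t w : 0 <= w -> 0 <= t <= 1 -> G (t * w) <= t * G w.
Proof.
move=> w0 /andP[t0 t1]; rewrite /G -psumZ//.
have e1 := entire_G; have e2 := entireZ (k := t) entire_G.
apply: lim_series_le; [exact: e1|exact: e2|move=> [|n]].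
  by rewrite /= h_even// normr0 mulr0 !mul0r.
rewrite /= exprMn [t * _]mulrC -mulrA ler_wpM2l//.
rewrite ler_wpM2r ?exprn_ge0// exprS ler_piMr//.
by rewrite exprn_ile1.
Qed.

(** The ridge argument is [rho / 2] scaled by [1 + cos phi], a factor in [[0, 1]] on this
    half-circle, so [majorant_scale] extracts it. *)
Lemma ridge_upper rho phi : 0 <= rho -> cos phi <= 0 ->
  u rho phi <= (1 + cos phi) * G (rho / 2).
Proof.
move=> rho0 cphi; have c1 : 0 <= 1 + cos phi by have := cos_geN1 phi; lra.
apply: le_trans (ridge phi rho0) _.
apply: le_trans (ler_norm _) _; apply: le_trans (ler_norm_psum _ entire_h) _.
rewrite ger0_norm; last by rewrite mulr_ge0// divr_ge0.
rewrite mulrCA; apply: majorant_scale; first by rewrite divr_ge0.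
by rewrite c1 gerDl.
Qed.

(** A half-turn exchanges the two half-circles and, [h] being odd, changes the sign of [u]. *)
Lemma ridge_lower rho phi : 0 <= rho -> 0 <= cos phi ->
  - ((1 - cos phi) * G (rho / 2)) <= u rho phi.
Proof.
move=> rho0 cphi; have := @ridge_upper rho (phi + pi) rho0.
by rewrite ridge_antiperiodic cosDpi oppr_le0 lerNl; apply.
Qed.

(* The test function [m cos phi - s cos (m phi)] has the sign of [cos phi], so
   only the half of the ridge bounds that is of size [G (rho / 2)] is used. *)
Lemma ridge_test rho phi s m : 0 <= rho -> odd m -> `|s| = 1 ->
  - (m%:R / 2 * G (rho / 2)) <=
  u rho phi * (m%:R * cos phi - s * cos (m%:R * phi)).
Proof.
move=> rho0 om s1; set K := m%:R * cos phi - _; set g := G (rho / 2).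
have g0 : 0 <= g by apply: majorant_ge0; rewrite divr_ge0.
have := norm_cos_odd phi om.
have -> : `|cos (m%:R * phi)| = `|s * cos (m%:R * phi)| by rewrite normrM s1 mul1r.
rewrite ler_norml => /andP[k1 k2].
have m0 : 0 <= m%:R :> R by [].
have [c0|c0] := leP 0 (cos phi).
  have low := ridge_lower rho0 c0; rewrite -/g in low.
  rewrite (ger0_norm c0) in k1 k2.
  have K0 : 0 <= K by rewrite /K; lra.
  have K1 : K <= 2 * m%:R * cos phi by rewrite /K; lra.
  apply: le_trans (ler_wpM2r K0 low).
  have c1 : 0 <= 1 - cos phi by have := cos_le1 phi; lra.
  have : (1 - cos phi) * g * K <= (1 - cos phi) * g * (2 * m%:R * cos phi).
    by rewrite ler_wpM2l// mulr_ge0.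
  (* This square encodes [2 c (1 - c) <= 1 / 2] at [c = cos phi], which is where the constant
     [m / 2] comes from. *)
  have : 0 <= m%:R * g * (1 - 2 * cos phi) ^+ 2 / 2.
    by rewrite divr_ge0// mulr_ge0 ?sqr_ge0// mulr_ge0.
  nra.
have upp := ridge_upper rho0 (ltW c0); rewrite -/g in upp.
rewrite (ltr0_norm c0) in k1 k2.
have K0 : K <= 0 by rewrite /K; lra.
have K1 : 2 * m%:R * cos phi <= K by rewrite /K; lra.
apply: le_trans (ler_wnM2r K0 upp).
have c1 : 0 <= 1 + cos phi by have := cos_geN1 phi; lra.
have : (1 + cos phi) * g * (2 * m%:R * cos phi) <= (1 + cos phi) * g * K.
  by rewrite ler_wpM2l// mulr_ge0.
have : 0 <= m%:R * g * (1 + 2 * cos phi) ^+ 2 / 2.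
  by rewrite divr_ge0// mulr_ge0 ?sqr_ge0// mulr_ge0.
nra.
Qed.

Let S rho phi L := \sum_(n < L) h n * rho ^+ n * cos (n%:R * phi).

(** The remainder is dominated by the tail of [G rho], which does not involve [phi]; one truncation
    therefore serves all the angles of the average. *)
Lemma partial_sum_approx rho e : 0 <= rho -> 0 < e ->
  \forall L \near \oo, forall phi, `|u rho phi - S rho phi L| <= e.
Proof.
move=> rho0 e0.
have cG : pseries (fun n => `|h n|) rho @ \oo --> G rho by exact: cvg_psum.
have /cvgrPdist_le/(_ e e0) := cG; apply: filterS => L HL phi.
have cu : pseries (twc h phi) rho @ \oo --> u rho phi.
  exact: cvg_psum (entire_twc entire_h).
have SE : S rho phi L = pseries (twc h phi) rho L.
  rewrite /S /pseries /series/= big_mkord; apply: eq_bigr => n _.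
  by rewrite /twc mulrAC.
rewrite SE; apply: le_trans HL; apply: le_trans (ler_norm _).
have c1 : (fun n => `|pseries (twc h phi) rho n - pseries (twc h phi) rho L|)
    @ \oo --> `|u rho phi - pseries (twc h phi) rho L|.
  by apply: cvg_norm; apply: cvgB => //; exact: cvg_cst.
have c2 : (fun n => pseries (fun n => `|h n|) rho n - pseries (fun n => `|h n|) rho L)
    @ \oo --> G rho - pseries (fun n => `|h n|) rho L.
  by apply: cvgB => //; exact: cvg_cst.
rewrite -(cvg_lim _ c1)// -(cvg_lim _ c2)//.
apply: ler_lim; [by apply: cvgP c1|by apply: cvgP c2|].
exists L => // n /= Ln; apply: le_trans (norm_series_sub _ Ln) _.
rewrite !sub_series_geq//; apply: ler_sum => k _.
rewrite /twc !normrM (ger0_norm (exprn_ge0 k rho0)).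
by rewrite ler_wpM2r ?exprn_ge0// ler_piMr// cos_max.
Qed.

(** A discrete Fourier extraction, exact because every frequency [p < L] satisfies [p + q < N]. *)
Lemma sum_partial_sum_cos rho L q N : (0 < q < L)%N -> (L + q < N)%N ->
  \sum_(j < N) S rho (angle R N j) L * cos (q%:R * angle R N j) =
  h q * rho ^+ q * (N%:R / 2).
Proof.
move=> /andP[q0 qL] LN; rewrite /S.
under eq_bigr do rewrite mulr_suml.
rewrite exchange_big/= (bigD1 (Ordinal qL))//= [X in _ + X]big1 ?addr0.
  under eq_bigr do rewrite -mulrA.
  by rewrite -mulr_sumr sum_cos_angle2 ?eqxx ?mul1r//; lia.
move=> p pq; under eq_bigr do rewrite -mulrA.
rewrite -mulr_sumr sum_cos_angle2 //; last by have := ltn_ord p; lia.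
have /negbTE-> : (p : nat) != q by apply: contra_neq pq => pq; exact: val_inj.
by rewrite mul0r mulr0.
Qed.

(** Averaging [ridge_test] over equally spaced angles leaves only the coefficients of index 1 and
    [m]. *)
Lemma ridge_coef rho m : 0 <= rho -> odd m ->
  `|h m| * rho ^+ m <= m%:R * (`|h 1%N| * rho + G (rho / 2)).
Proof.
move=> rho0 om; have m0 : (0 < m)%N by rewrite odd_gt0.
(* A sign of modulus 1 even when [h m = 0], as [ridge_test] requires. *)
pose s : R := if 0 <= h m then 1 else -1.
have s1 : `|s| = 1 by rewrite /s; case: ifP; rewrite ?normrN normr1.
have sh : s * h m = `|h m|.
  rewrite /s; have [h0|h0] := leP 0 (h m); first by rewrite mul1r ger0_norm.
  by rewrite mulN1r ltr0_norm.
apply/ler_addgt0Pr => e e0.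
(* As the test function is bounded by [2 m], truncation costs at most [e' * 2 m = e / 2]; clearing
   the factor [1 / 2] of the average turns this into [e]. *)
pose e' := e / (4 * m%:R).
have m0R : (0 : R) < m%:R by rewrite ltr0n.
have e'0 : 0 < e' by rewrite divr_gt0// mulr_gt0.
near \oo => L.
have HL : forall phi, `|u rho phi - S rho phi L| <= e'.
  by near: L; exact: partial_sum_approx.
have mL : (m < L)%N by near: L; exact: nbhs_infty_gt.
pose N := (L + m).+1; pose t j := angle R N j.
pose K phi := m%:R * cos phi - s * cos (m%:R * phi).
have NR : (0 : R) < N%:R by rewrite ltr0n.
have Kle phi : `|K phi| <= 2 * m%:R.
  rewrite /K; apply: le_trans (ler_normB _ _) _.
  rewrite !normrM s1 mul1r normr_nat.
  have := cos_max phi; have := cos_max (m%:R * phi).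
  have : (1 : R) <= m%:R by rewrite ler1n.
  set A := `|_|; set B := `|_|; nra.
have : \sum_(j < N) S rho (t j) L * K (t j) =
    (m%:R * (h 1%N * rho) - s * (h m * rho ^+ m)) * (N%:R / 2).
  have h1 := @sum_partial_sum_cos rho L 1 N _ _.
  have hm := @sum_partial_sum_cos rho L m N _ _.
  rewrite mulrBl -!mulrA (mulrA (h m)) -hm; [|by rewrite m0|by rewrite /N].
  rewrite (mulrA (h 1%N)) -[X in h 1%N * X]expr1 -h1; [|by lia|by rewrite /N; lia].
  rewrite !mulr_sumr -sumrB; apply: eq_bigr => j _.
  by rewrite /K mul1r; ring.
move=> sumE.
have : \sum_(j < N) (- (m%:R / 2 * G (rho / 2)) - e' * (2 * m%:R)) <=
    \sum_(j < N) S rho (t j) L * K (t j).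
  apply: ler_sum => j _; have := ridge_test (t j) rho0 om s1.
  rewrite -/(K (t j)) => Ht.
  have : `|(u rho (t j) - S rho (t j) L) * K (t j)| <= e' * (2 * m%:R).
    by rewrite normrM ler_pM.
  rewrite ler_norml => /andP[_]; lra.
rewrite sumE sumr_const card_ord -[leLHS]mulr_natr => Hsum.
have : - (m%:R / 2 * G (rho / 2)) - e' * (2 * m%:R) <=
    (m%:R * (h 1%N * rho) - s * (h m * rho ^+ m)) / 2.
  by rewrite -(ler_pM2r NR); apply: (le_trans Hsum); rewrite -mulrA [_^-1 * _]mulrC.
have -> : e' * (2 * m%:R) = e / 2 by rewrite /e'; field; rewrite gt_eqF.
have -> : s * (h m * rho ^+ m) = `|h m| * rho ^+ m by rewrite mulrA sh.
have : m%:R * (h 1%N * rho) <= m%:R * (`|h 1%N| * rho).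
  by rewrite ler_wpM2l// ler_wpM2r// ler_norm.
lra.
Unshelve. all: by end_near. Qed.

Let tau (n : nat) : R := if odd n && (2 < n)%N then n%:R / 2 ^+ n else 0.

Lemma sum_tau N : series tau N <= 11 / 18.
Proof.
(* The closed form of the tail of [tau] from index [n > 2] on: partial sum plus tail stays constant,
   equal to [r 3 = 11 / 18]. *)
pose r n : R :=
  (if odd n then 4 / 3 * n%:R + 8 / 9 else 2 / 3 * n%:R + 10 / 9) / 2 ^+ n.
have r0 n : 0 <= r n.
  by rewrite /r divr_ge0 ?exprn_ge0//; case: ifP => _; rewrite addr_ge0// mulr_ge0.
have step k : (2 < k)%N -> tau k + r k.+1 = r k.
  move=> k2; rewrite /tau /r k2 andbT /= exprS -natr1.
  have p0 : 2 ^+ k != 0 :> R by rewrite expf_neq0.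
  by case: (odd k); rewrite /= ?add0r; field.
have E n : series tau n.+3 + r n.+3 = 11 / 18.
  elim: n => [|n IHn]; last by rewrite -IHn seriesSr -addrA step.
  by rewrite /series/= !big_nat_recr//= big_geq// /tau /r/=; lra.
apply: (@le_trans _ _ (series tau N.+3)).
  apply: ler_series_nneg; last by lia.
  by move=> k; rewrite /tau; case: ifP => // _; rewrite divr_ge0 ?exprn_ge0.
by rewrite -(E N) lerDl.
Qed.

(** Taking [rho = 2 w] in [ridge_coef] bounds the [n]-th term of [G w] by [n / 2 ^ n] times [B].
    Summation gives [G w <= |h 1| w + 11/18 (2 |h 1| w + G w)], and solving for [G w] yields the
    constant [40 / 7 <= 6]. *)
Lemma ridge_linear_growth w : 0 <= w -> G w <= 6 * `|h 1%N| * w.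
Proof.
move=> w0; pose B := 2 * `|h 1%N| * w + G w.
have B0 : 0 <= B by rewrite addr_ge0 ?majorant_ge0// mulr_ge0// mulr_ge0.
have tm n : `|h n| * w ^+ n <= (n == 1%N)%:R * (`|h 1%N| * w) + tau n * B.
  have [on|/h_even->] := boolP (odd n); last first.
    rewrite normr0 mul0r addr_ge0 ?mulr_ge0//.
    by rewrite /tau; case: ifP => // _; rewrite divr_ge0 ?exprn_ge0.
  have [->|n1] := eqVneq n 1%N; first by rewrite expr1 mul1r /tau/= mul0r addr0.
  have n2 : (2 < n)%N by case: n on n1 => [|[|[]]].
  rewrite mul0r add0r /tau on n2/=.
  have : 0 <= 2 * w by rewrite mulr_ge0.
  move=> /ridge_coef/(_ on); rewrite exprMn.
  have -> : 2 * w / 2 = w by field.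
  have p2 : (0 : R) < 2 ^+ n by rewrite exprn_gt0.
  move=> Hn; rewrite mulrAC ler_pdivlMr//.
  by apply: le_trans (le_trans Hn _); [rewrite -mulrA [w ^+ n * _]mulrC|
    rewrite ler_wpM2l// /B; lra].
have : G w <= `|h 1%N| * w + 11 / 18 * B.
  apply: limr_le; first exact: entire_G.
  apply: nearW => N; rewrite /pseries.
  apply: (@le_trans _ _ (\sum_(0 <= n < N)
      ((n == 1%N)%:R * (`|h 1%N| * w) + tau n * B))).
    by rewrite /series/=; apply: ler_sum => n _; exact: tm.
  rewrite big_split/= -!mulr_suml lerD//; last by rewrite ler_wpM2r// sum_tau.
  rewrite ler_piMl ?mulr_ge0//.
  have [N1|N1] := leqP N 1%N.
    by rewrite big_nat big1 ?ler01// => i iN; have -> : i = 0%N by lia.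
  rewrite (bigD1_seq 1%N)/= ?mem_index_iota ?iota_uniq//.
  by rewrite big1 ?addr0// => i /negbTE->.
rewrite /B; have : 0 <= `|h 1%N| * w by rewrite mulr_ge0.
lra.
Qed.

Lemma ridge_rigidity n : n != 1%N -> h n = 0.
Proof.
move=> n1; have [on|/h_even//] := boolP (odd n).
have n2 : (2 < n)%N by case: n on n1 => [|[|[]]].
apply/eqP/contraT => hn0; pose C := 6 * `|h 1%N|.
have hn : 0 < `|h n| by rewrite normr_gt0.
have C0 : 0 <= C by rewrite mulr_ge0.
(* Here [|h n| w = |h n| + C], whereas linear growth with [n >= 2] and [w >= 1] would force
   [|h n| w <= C]. *)
pose w := 1 + C / `|h n|.
have w1 : 1 <= w by rewrite lerDl divr_ge0// ltW.
have w0 : 0 <= w by rewrite (le_trans _ w1).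
have : `|h n| * w ^+ n <= C * w.
  apply: le_trans (ridge_linear_growth w0).
  apply: (@le_trans _ _ (pseries (fun n => `|h n|) w n.+1)).
    rewrite /pseries /series/= big_nat_recr//= lerDr.
    by apply: sumr_ge0 => k _; rewrite mulr_ge0 ?exprn_ge0.
  apply: limr_ge; first exact: entire_G.
  exists n.+1 => // k /= nk; apply: ler_series_nneg => // i.
  by rewrite mulr_ge0 ?exprn_ge0.
have : `|h n| * w ^+ 2 <= `|h n| * w ^+ n.
  by rewrite ler_wpM2l// ler_weXn2l// ltnW.
have : `|h n| * w = `|h n| + C by rewrite /w; field; rewrite gt_eqF.
rewrite expr2 => E1 E2 E3.
have : (`|h n| * w) * w <= C * w by rewrite -mulrA (le_trans E2).
rewrite E1 ler_pM2r; last by rewrite (lt_le_trans _ w1).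
lra.
Qed.

End RidgeRigidity.

(** * Series and exponential moments *)

Section EvenSeries.
Variable R : realType.
Implicit Types (a : R^nat) (t w : R).

Lemma pseries_double a t n : (forall k, odd k -> a k = 0) ->
  pseries (fun k => a k.*2) (t ^+ 2) n = pseries a t n.*2.
Proof.
move=> a0; elim: n => [|n IHn]; first by rewrite /pseries /series/= !big_geq.
rewrite /pseries in IHn *; rewrite doubleS !seriesSr IHn /= (a0 n.*2.+1).
  by rewrite mul0r addr0 -exprM mul2n.
by rewrite /= odd_double.
Qed.

Lemma cvg_double (l : R) (f : R^nat) : f @ \oo --> l -> f n.*2 @[n --> \oo] --> l.
Proof.
move=> fl; apply: (cvg_comp (fun n => n.*2) f _ fl) => A [N _ NA].
by exists N => // n /= Nn; apply: NA => /=; lia.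
Qed.

Lemma cvg_psum_double a t : entire a -> (forall k, odd k -> a k = 0) ->
  pseries (fun k => a k.*2) (t ^+ 2) @ \oo --> psum a t.
Proof.
move=> ea a0; rewrite (_ : pseries _ _ = fun n => pseries a t n.*2).
  by apply: cvg_double; exact: cvg_psum.
by apply/funext => n; exact: pseries_double.
Qed.

Lemma psum_double a t : entire a -> (forall k, odd k -> a k = 0) ->
  psum (fun k => a k.*2) (t ^+ 2) = psum a t.
Proof. by move=> ea a0; apply/cvg_lim => //; exact: cvg_psum_double. Qed.

Lemma entire_double a : entire a -> (forall k, odd k -> a k = 0) ->
  entire (fun k => a k.*2).
Proof.
move=> ea a0 w; pose t := Num.sqrt (`|w| + 1).
apply: (@is_cvg_pseries_inside _ _ (t ^+ 2)).
  by apply/cvg_ex; exists (psum a t); exact: cvg_psum_double.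
by rewrite sqr_sqrtr ?addr_ge0// [ltRHS]ger0_norm ?addr_ge0// ltrDl.
Qed.

Lemma psum_altn a w : psum (altn a) w = psum a (- w).
Proof.
rewrite /psum /pseries; congr (limn (series _)).
by apply/funext => n; rewrite /altn /= [in RHS]exprNn; ring.
Qed.

End EvenSeries.

(** * Expectations of power series in a random variable *)

Section ExponentialMoments.
Context d (T : measurableType d) (R : realType) (P : probability T R).
Variable Y : T -> R.
Hypothesis mY : measurable_fun [set: T] Y.
Hypothesis iY : forall t : R, P.-integrable [set: T] (fun w => (expR (t * Y w))%:E).
Implicit Types (e : R^nat) (t : R).

Definition moment n : R := \int[P]_w (Y w ^+ n).

Lemma expR_norm_le (s : R) : expR `|s| <= expR s + expR (- s).
Proof.
have [s0|s0] := leP 0 s; first by rewrite ger0_norm// lerDl expR_ge0.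
by rewrite ltr0_norm// lerDr expR_ge0.
Qed.

Lemma exprn_le_expR (s : R) n : `|s| ^+ n / n`!%:R <= expR `|s|.
Proof.
case: n => [|n].
  by rewrite expr0 fact0 divr1 -expR0 ler_expR.
by apply: le_trans (expR_ge1Dxn n (normr_ge0 s)); rewrite lerDr.
Qed.

Lemma integrable_dominated_exp (f : T -> R) (C t : R) :
  measurable_fun [set: T] f ->
  (forall w, `|f w| <= C * expR `|t * Y w|) ->
  P.-integrable [set: T] (EFin \o f).
Proof.
move=> mf fC.
(* The sign of [C] is read off at some point of [T], which exists since a probability space is not
   empty. *)
have C0 : 0 <= C.
  have [w _] : exists w : T, True.
    apply/not_existsP => T0; have := @probability_setT _ _ _ P.
    rewrite (_ : [set: T] = set0) ?measure0; last first.
      by rewrite -subset0 => w _; case: (T0 w).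
    by move/eqP; rewrite eq_sym onee_eq0.
  by rewrite -(pmulr_lge0 _ (expR_gt0 `|t * Y w|)); apply: le_trans (fC w).
apply: (@le_integrable _ _ _ _ _ measurableT _
  (fun w => (C * (expR (t * Y w) + expR (- t * Y w)))%:E)).
- exact/measurable_EFinP.
- move=> w _; rewrite /= lee_fin; apply: le_trans (fC w) _.
  rewrite [leRHS]ger0_norm ?mulr_ge0 ?addr_ge0 ?expR_ge0//.
  by rewrite ler_wpM2l// mulNr expR_norm_le.
- under eq_fun do rewrite EFinM EFinD.
  by apply: integrableZl => //; apply: integrableD => //; exact: iY.
Qed.

Lemma integrable_power n : P.-integrable [set: T] (EFin \o (fun w => Y w ^+ n)).
Proof.
apply: (@integrable_dominated_exp _ n`!%:R 1); first exact: measurable_funX.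
by move=> w; rewrite mul1r normrX mulrC -ler_pdivrMr ?exprn_le_expR.
Qed.

Lemma Rintegral_pseries e t n :
  P.-integrable [set: T] (EFin \o (fun w => pseries e (t * Y w) n)) /\
  \int[P]_w (pseries e (t * Y w) n) = pseries (fun k => e k * moment k) t n.
Proof.
elim: n => [|n [IH1 IH2]].
  rewrite /pseries /series/=; split.
    rewrite (_ : _ \o _ = cst 0%E); first exact: integrable0.
    by apply/funext => w /=; rewrite big_geq.
  rewrite big_geq//.
  under eq_Rintegral do rewrite big_geq//.
  by rewrite Rintegral_cst// mul0r.
have i2 : P.-integrable [set: T] (EFin \o (fun w => e n * t ^+ n * Y w ^+ n)).
  rewrite (_ : _ \o _ = fun w => ((e n * t ^+ n)%:E * (Y w ^+ n)%:E)%E).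
    by apply: integrableZl => //; exact: integrable_power.
  by apply/funext.
have E w : pseries e (t * Y w) n.+1 =
    pseries e (t * Y w) n + e n * t ^+ n * Y w ^+ n.
  by rewrite /pseries seriesSr /= exprMn mulrA.
split.
  rewrite (_ : _ \o _ = (EFin \o (fun w => pseries e (t * Y w) n)) \+
    (EFin \o (fun w => e n * t ^+ n * Y w ^+ n))); first exact: integrableD.
  by apply/funext => w; rewrite /= E.
under eq_Rintegral do rewrite E.
rewrite RintegralD// IH2 RintegralZl//; last exact: integrable_power.
by rewrite /pseries seriesSr mulrAC.
Qed.

Lemma measurable_psum e t : entire e ->
  measurable_fun [set: T] (fun w => psum e (t * Y w)).
Proof.
move=> ee; apply: (measurableT_comp (f := psum e)).
  by apply: continuous_measurable_fun; exact: continuous_psum.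
exact: measurable_funM.
Qed.

(** Coefficientwise domination by the exponential series: all partial sums at [t Y] are then bounded
    by [exp |t Y|]. It covers exp, cos, sin and their rotations at once. *)
Definition fact_bounded e := forall n, `|e n| <= n`!%:R^-1.

Lemma entire_fact : entire (fun n => n`!%:R^-1 : R).
Proof.
by move=> x; rewrite /pseries -(exp_coeffE x); exact: is_cvg_series_exp_coeff.
Qed.

Lemma psum_fact (x : R) : psum (fun n => n`!%:R^-1) x = expR x.
Proof. by rewrite expRE. Qed.

Lemma fact_bounded_entire e : fact_bounded e -> entire e.
Proof.
move=> be; apply: entire_le entire_fact => n.
by apply: le_trans (be n) _; exact: ler_norm.
Qed.

Lemma norm_pseries_fact e (x : R) n : fact_bounded e ->
  `|pseries e x n| <= expR `|x|.
Proof.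
move=> be; rewrite -psum_fact; apply: (@le_trans _ _ (pseries (fun n => n`!%:R^-1) `|x| n)).
  apply: le_trans (ler_norm_sum _ _ _) _; apply: ler_sum => k _.
  by rewrite normrM normrX ler_wpM2r ?exprn_ge0.
apply: limr_ge; first exact: entire_fact.
exists n => // k /= nk; apply: ler_series_nneg => // i.
by rewrite mulr_ge0 ?exprn_ge0// invr_ge0.
Qed.

(** Dominated convergence with majorant [exp(t Y) + exp(-t Y)], integrable by hypothesis, allows
    expectation term by term. *)
Lemma expectation_psum e t : fact_bounded e ->
  P.-integrable [set: T] (EFin \o (fun w => psum e (t * Y w))) /\
  pseries (fun k => e k * moment k) t @ \oo --> \int[P]_w psum e (t * Y w).
Proof.
move=> be; have ee := fact_bounded_entire be.
have mps n : measurable_fun [set: T] (fun w => pseries e (t * Y w) n).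
  have [/measurable_int + _] := Rintegral_pseries e t n.
  by move/measurable_EFinP.
have lim_ps : {ae P, forall w, [set: T] w ->
    (pseries e (t * Y w) n)%:E @[n --> \oo] --> (psum e (t * Y w))%:E}.
  apply: aeW => w _; apply: cvg_EFin; last exact: cvg_psum.
  exact: nearW.
have idom : P.-integrable [set: T]
    (fun w => (expR (t * Y w) + expR (- t * Y w))%:E).
  by under eq_fun do rewrite EFinD; apply: integrableD => //; exact: iY.
have dom : {ae P, forall w n, [set: T] w -> (`|(pseries e (t * Y w) n)%:E| <=
    (expR (t * Y w) + expR (- t * Y w))%:E)%E}.
  apply: aeW => w n _; rewrite /= lee_fin.
  by apply: le_trans (norm_pseries_fact _ _ be) _; rewrite mulNr expR_norm_le.
have [i1 _ c1] := dominated_convergence measurableT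
  (fun n => (measurable_EFinP _ _).2 (mps n))
  ((measurable_EFinP _ _).2 (measurable_psum t ee)) lim_ps idom dom.
split.
  exact: i1.
have : (fun n => fine (\int[P]_w (pseries e (t * Y w) n)%:E)%E) @ \oo -->
    \int[P]_w psum e (t * Y w).
  apply: fine_cvg; rewrite fineK; first exact: c1.
  exact: integrable_fin_num.
rewrite (_ : (fun n => fine _) = pseries (fun k => e k * moment k) t)//.
by apply/funext => n; have [_ <-] := Rintegral_pseries e t n.
Qed.

Lemma integrable_psum e t : fact_bounded e ->
  P.-integrable [set: T] (EFin \o (fun w => psum e (t * Y w))).
Proof. by move=> /(expectation_psum t)[]. Qed.

Lemma entire_moment e : fact_bounded e -> entire (fun k => e k * moment k).
Proof.
move=> be t; have [_ c] := expectation_psum t be.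
by apply/cvg_ex; exists (\int[P]_w psum e (t * Y w)).
Qed.

Lemma Rintegral_psum e t : fact_bounded e ->
  \int[P]_w psum e (t * Y w) = psum (fun k => e k * moment k) t.
Proof.
move=> be; have [_ c] := expectation_psum t be.
by apply/esym/cvg_lim.
Qed.

End ExponentialMoments.

(** * Modulus bounds for exp and cosh along a ray *)

Section EvenExponential.
Variable R : realType.
Implicit Types (a : R^nat) (theta s p q : R).

Lemma psum_linear a (x : R) : (forall n, n != 1%N -> a n = 0) ->
  psum a x = a 1%N * x.
Proof.
move=> a0; apply: lim_near_cst => //; near=> n.
have n1 : (1 < n)%N by near: n; exact: nbhs_infty_gt.
rewrite /pseries /series/= (bigD1_seq 1%N)/= ?mem_index_iota ?iota_uniq//.
by rewrite big1 ?addr0 ?expr1// => i /a0 ->; rewrite mul0r.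
Unshelve. all: by end_near. Qed.

Lemma entire_delta1 : entire (delta1 R).
Proof.
apply: entire_le (@entire_fact R) => n; rewrite /delta1.
by case: n => [|n]; rewrite ?fact0 ?invr1 ?normr0.
Qed.

Lemma psum_delta1 (x : R) : psum (delta1 R) x = 1.
Proof.
apply: lim_near_cst => //; near=> n.
have -> : n = n.-1.+1 by rewrite prednK//; near: n; exact: nbhs_infty_gt.
rewrite /pseries /series/= big_nat_recl// expr0 mulr1 big1 ?addr0// => i _.
by rewrite /delta1 mul0r.
Unshelve. all: by end_near. Qed.

Let F : R^nat := fun n => n`!%:R^-1.
Let X1 : R^nat := fun n => (n == 1%N)%:R.

Lemma entire_X1 : entire X1.
Proof.
apply: entire_le (@entire_fact R) => n; rewrite /X1.
have [->|_] := eqVneq n 1%N; first by rewrite (_ : 1`! = 1%N)// invr1.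
by rewrite normr0.
Qed.

(** This is [|e^z| = e^(Re z)] at [z = s e^(i theta)]: the case of [psum_twc_tws_sqr] where the
    exponent is the series [z], with coefficients [X1]. *)
Lemma exp_modulus s theta :
  psum (twc F theta) s ^+ 2 + psum (tws F theta) s ^+ 2 =
  expR (s * cos theta) ^+ 2.
Proof.
rewrite (psum_twc_tws_sqr (c := X1)).
- rewrite psum_linear => [|n /negbTE n1]; last by rewrite /twc /X1 n1 mul0r.
  by rewrite /twc /X1 eqxx !mul1r -expRM_natl [s * _]mulrC.
- exact: entire_fact.
- exact: entire_X1.
- by rewrite /F fact0 invr1.
- by [].
- rewrite (_ : pseries_diffs X1 = delta1 R).
    by rewrite convC conv1 /F pseries_diffs_inv_fact.
  apply/funext => n; rewrite /pseries_diffs /X1 /delta1 eqSS.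
  by case: eqP => [->|]; rewrite ?mulr1 ?mulr0.
Qed.

Definition evenpart a : R^nat := fun n => if odd n then 0 else a n.

Lemma psum_evenpart a s : entire a ->
  psum (evenpart a) s = (psum a s + psum a (- s)) / 2.
Proof.
move=> ea; rewrite -(psum_altn a) -psumD//; last exact: entire_altn.
rewrite mulrC -psumZ; last by apply: entireD => //; exact: entire_altn.
congr (psum _ s); apply/funext => n; rewrite /evenpart /altn -signr_odd.
by case: (odd n); rewrite ?expr1 ?expr0; field.
Qed.

(** Cauchy-Schwarz between [(p, q)] and the real and imaginary parts of [e^z]. A bound linear in
    these parts, unlike one on the modulus, can be integrated directly. *)
Lemma expR_modulus_cs s theta p q :
  p * psum (twc F theta) s + q * psum (tws F theta) s <=
  Num.sqrt (p ^+ 2 + q ^+ 2) * expR (s * cos theta).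
Proof.
set C := psum _ _; set S := psum _ _.
apply: le_trans (ler_norm _) _.
rewrite -(@ler_pXn2r _ 2) ?nnegrE ?mulr_ge0 ?sqrtr_ge0 ?expR_ge0//.
rewrite exprMn sqr_sqrtr ?addr_ge0 ?sqr_ge0// -exp_modulus -/C -/S.
rewrite real_normK ?num_real//.
have := sqr_ge0 (p * S - q * C); nra.
Qed.

Lemma even_modulus_cs s theta p q :
  p * psum (evenpart (twc F theta)) s + q * psum (evenpart (tws F theta)) s <=
  Num.sqrt (p ^+ 2 + q ^+ 2) *
    ((expR (s * cos theta) + expR (- (s * cos theta))) / 2).
Proof.
have eF := @entire_fact R.
rewrite !psum_evenpart; [|exact: entire_tws|exact: entire_twc].
have := expR_modulus_cs s theta p q; have := expR_modulus_cs (- s) theta p q.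
by rewrite mulNr; lra.
Qed.

End EvenExponential.

(** * From the cosine identity to a Gaussian moment generating function *)

Section GaussianCharacterization.
Context d (T : measurableType d) (R : realType) (P : probability T R).
Variable Y : T -> R.
Hypothesis mY : measurable_fun [set: T] Y.
Hypothesis iY : forall t : R, P.-integrable [set: T] (fun w => (expR (t * Y w))%:E).
Implicit Types t r theta phi : R.

Let M t := \int[P]_w expR (t * Y w).
Let F : R^nat := fun n => n`!%:R^-1.
Let mom := moment P Y.

Lemma moment0 : mom 0 = 1.
Proof.
rewrite /mom /moment; under eq_Rintegral do rewrite expr0.
by rewrite Rintegral_cst//= probability_setT mulr1.
Qed.

Lemma fact_bounded_twc theta : fact_bounded (twc F theta).
Proof.
move=> n; rewrite /twc normrM [X in X * _]ger0_norm ?invr_ge0//.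
by rewrite ler_piMr ?invr_ge0// cos_max.
Qed.

Lemma fact_bounded_tws theta : fact_bounded (tws F theta).
Proof.
move=> n; rewrite /tws normrM [X in X * _]ger0_norm ?invr_ge0//.
by rewrite ler_piMr ?invr_ge0// sin_max.
Qed.

Lemma fact_boundedF : fact_bounded F.
Proof. by move=> n; rewrite ger0_norm ?invr_ge0. Qed.

Lemma fact_bounded_even (e : R^nat) : fact_bounded e -> fact_bounded (evenpart e).
Proof.
by move=> be n; rewrite /evenpart; case: ifP => // _; rewrite normr0 invr_ge0.
Qed.

(** The coefficients of the series [A] with [E cosh(t Y) = A(t^2)] and [E cos(t Y) = A(-t^2)]. *)
Definition even_moment : R^nat := fun k => F k.*2 * mom k.*2.

Let a : R^nat := fun n => evenpart F n * mom n.

Let entire_a : entire a.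
Proof. exact/(entire_moment mY iY)/fact_bounded_even/fact_boundedF. Qed.

Let a_odd n : odd n -> a n = 0.
Proof. by move=> on; rewrite /a /evenpart on mul0r. Qed.

Let aE k : a k.*2 = even_moment k.
Proof. by rewrite /a /evenpart odd_double. Qed.

Lemma entire_even_moment : entire even_moment.
Proof.
by have := entire_double entire_a a_odd; under eq_fun do rewrite aE.
Qed.

Lemma mgfE t : M t = psum (fun n => F n * mom n) t.
Proof.
rewrite /M -Rintegral_psum//; last exact: fact_boundedF.
by apply: eq_Rintegral => w _; rewrite psum_fact.
Qed.

(** For [trig] the cosine or the sine this is the real or imaginary part of [A(z^2) = E cosh(z Y)]
    at [z = t e^(i theta)]; squaring [z] doubles the angle. *)
Lemma psum_even_trig (trig : R -> R) t theta :
  (forall x, `|trig x| <= 1) ->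
  psum (fun k => even_moment k * trig (k%:R * (theta *+ 2))) (t ^+ 2) =
  \int[P]_w psum (evenpart (fun n => F n * trig (n%:R * theta))) (t * Y w).
Proof.
move=> trig1.
have be : fact_bounded (evenpart (fun n => F n * trig (n%:R * theta))).
  apply: fact_bounded_even => n; rewrite normrM [X in X * _]ger0_norm ?invr_ge0//.
  by rewrite ler_piMr ?invr_ge0// trig1.
rewrite Rintegral_psum// -[RHS]psum_double.
- congr (psum _ _); apply/funext => k; rewrite /even_moment /evenpart odd_double.
  have -> : k.*2%:R * theta = k%:R * (theta *+ 2) by rewrite -mul2n natrM; ring.
  by rewrite -!mulrA [trig _ * _]mulrC.
- exact: entire_moment.
- by move=> k ok; rewrite /evenpart ok mul0r.
Qed.

Lemma Rintegral_even_exp t :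
  P.-integrable [set: T]
    (EFin \o (fun w => (expR (t * Y w) + expR (- (t * Y w))) / 2)) /\
  \int[P]_w ((expR (t * Y w) + expR (- (t * Y w))) / 2) = (M t + M (- t)) / 2.
Proof.
have i1 : P.-integrable [set: T] (EFin \o (fun w => expR (t * Y w))) by exact: iY.
have i2 : P.-integrable [set: T] (EFin \o (fun w => expR (- (t * Y w)))).
  by under eq_fun do rewrite -mulNr; exact: iY.
have i3 : P.-integrable [set: T]
    (EFin \o (fun w => expR (t * Y w) + expR (- (t * Y w)))).
  rewrite (_ : _ \o _ = (EFin \o (fun w => expR (t * Y w))) \+
    (EFin \o (fun w => expR (- (t * Y w))))); first exact: integrableD.
  by apply/funext => w.
split.
  under [X in _.-integrable _ X]eq_fun do rewrite /= EFinM.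
  exact: integrableZr.
rewrite RintegralZr// RintegralD//; congr ((_ + _) / 2).
by apply: eq_Rintegral => w _; rewrite mulNr.
Qed.

Lemma even_mgf t : (M t + M (- t)) / 2 = psum even_moment (t ^+ 2).
Proof.
have := @psum_even_trig (fun=> 1) t 0.
under eq_fun do rewrite mulr1; move=> ->; last by move=> _; rewrite normr1.
rewrite -(Rintegral_even_exp t).2; apply: eq_Rintegral => w _.
have -> : (fun n => F n * 1) = F by apply/funext => n; rewrite mulr1.
by rewrite psum_evenpart ?psum_fact//; exact: entire_fact.
Qed.

Lemma cos_even_moment t :
  \int[P]_w cos (t * Y w) = psum even_moment (- t ^+ 2).
Proof.
rewrite -psum_altn cosE.
pose e : R^nat := fun n => (~~ odd n)%:R * (-1) ^+ n./2 * n`!%:R^-1.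
have be : fact_bounded e.
  move=> n; rewrite /e normrM [X in _ * X]ger0_norm ?invr_ge0//.
  rewrite ler_piMl ?invr_ge0// normrM normrX normrN1 expr1n mulr1 normr_nat.
  by case: odd.
rewrite [LHS](Rintegral_psum mY iY t be) -[LHS]psum_double.
- congr (psum _ _); apply/funext => k.
  rewrite /e /altn /even_moment odd_double doubleK mul1r.
  by rewrite /F mulrA.
- exact: entire_moment.
- by move=> k ok; rewrite /e ok !mul0r.
Qed.

(** The ridge property [|A(z^2)| <= A((Re z)^2)] in squared form. Integrating [even_modulus_cs] with
    [(p, q)] equal to the real and imaginary parts of [A(z^2)] gives [N^2 <= N A((Re z)^2)] for
    [N = |A(z^2)|]. *)
Lemma expR_psum_bound r theta :
  psum (twc even_moment (theta *+ 2)) (r ^+ 2) ^+ 2 +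
  psum (tws even_moment (theta *+ 2)) (r ^+ 2) ^+ 2 <=
  psum even_moment ((r * cos theta) ^+ 2) ^+ 2.
Proof.
have eC := @psum_even_trig _ r theta (@cos_max R).
have eS := @psum_even_trig _ r theta (@sin_max R).
rewrite -/(twc _ _) -/(twc _ _) in eC; rewrite -/(tws _ _) -/(tws _ _) in eS.
set p := psum (twc _ _) _ in eC *; set q := psum (tws _ _) _ in eS *.
set N := Num.sqrt (p ^+ 2 + q ^+ 2).
have N2 : N ^+ 2 = p ^+ 2 + q ^+ 2 by rewrite sqr_sqrtr// addr_ge0 ?sqr_ge0.
have ic := integrable_psum mY iY r (fact_bounded_even (@fact_bounded_twc theta)).
have is_ := integrable_psum mY iY r (fact_bounded_even (@fact_bounded_tws theta)).
have [ie Ie] := Rintegral_even_exp (r * cos theta).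
rewrite even_mgf in Ie.
have combE (f g : T -> R) (x y : R) : P.-integrable [set: T] (EFin \o f) ->
    P.-integrable [set: T] (EFin \o g) ->
    P.-integrable [set: T] (EFin \o (fun w => x * f w + y * g w)) /\
    \int[P]_w (x * f w + y * g w) = x * \int[P]_w f w + y * \int[P]_w g w.
  move=> fi gi.
  have xf : P.-integrable [set: T] (EFin \o (fun w => x * f w)).
    rewrite (_ : _ \o _ = fun w => (x%:E * (EFin \o f) w)%E); first exact: integrableZl.
    by apply/funext => w.
  have yg : P.-integrable [set: T] (EFin \o (fun w => y * g w)).
    rewrite (_ : _ \o _ = fun w => (y%:E * (EFin \o g) w)%E); first exact: integrableZl.
    by apply/funext => w.
  split; last by rewrite RintegralD// !RintegralZl.
  rewrite (_ : _ \o _ = (EFin \o (fun w => x * f w)) \+ (EFin \o (fun w => y * g w))).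
    exact: integrableD.
  by apply/funext => w.
have [ipq Ipq] := combE _ _ p q ic is_.
rewrite -eC -eS -!expr2 -N2 in Ipq.
have [iN IN] := combE _ _ N 0 ie ie.
have : N ^+ 2 <= N * psum even_moment ((r * cos theta) ^+ 2).
  rewrite -Ie -Ipq -[leRHS]addr0 -[X in _ <= _ + X](mul0r (\int[P]_w
    ((expR (r * cos theta * Y w) + expR (- (r * cos theta * Y w))) / 2))) -IN.
  apply: le_Rintegral => // w _; rewrite mul0r addr0.
  have := even_modulus_cs (r * Y w) theta p q.
  by have -> : r * Y w * cos theta = r * cos theta * Y w by ring.
rewrite -N2; have : 0 <= N by rewrite sqrtr_ge0.
rewrite le_eqVlt => /predU1P[<- _|N0].
  by rewrite expr0n/= sqr_ge0.
rewrite {1}expr2 ler_pM2l// => NM.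
by rewrite lerXn2r// nnegrE ltW// (lt_le_trans N0).
Qed.

Lemma exp_cos_gaussian :
  (forall t, \int[P]_w cos (t * Y w) * M t = 1) ->
  forall t, M t = expR (t ^+ 2 * (\int[P]_w (Y w ^+ 2) / 2)).
Proof.
move=> H.
pose al := even_moment; pose A := psum al.
have eal : entire al by exact: entire_even_moment.
(* The cosine expectation is even in [t] and, by [H], nonzero, so it can be cancelled. *)
have Mev t : M (- t) = M t.
  have cosN_ : \int[P]_w cos (- t * Y w) = \int[P]_w cos (t * Y w).
    by apply: eq_Rintegral => w _; rewrite mulNr cosN.
  have c0 : \int[P]_w cos (t * Y w) != 0.
    by apply: contra_eq_neq (H t) => ->; rewrite mul0r eq_sym oner_neq0.
  by apply: (mulfI c0); rewrite H -cosN_ H.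
have MA t : M t = A (t ^+ 2) by rewrite /A -even_mgf Mev; field.
have AA w : 0 < w -> A w * A (- w) = 1.
  move=> /ltW w0; rewrite -(H (Num.sqrt w)) MA cos_even_moment sqr_sqrtr//.
  by rewrite mulrC.
have Acv : conv al (altn al) = delta1 R.
  have ealt := entire_altn eal.
  apply: psum_inj => [||x x0]; [exact: entire_conv|exact: entire_delta1|].
  by rewrite psum_conv// psum_altn AA// psum_delta1.
pose h := log_coef al.
have al0 : al 0%N = 1 by rewrite /al /even_moment /F moment0 fact0 invr1 mulr1.
have eh : entire h by exact: entire_log_coef.
have dal : pseries_diffs al = conv (pseries_diffs h) al.
  by rewrite log_coef_diffs log_diffs_conv.
have modE x phi := psum_twc_tws_sqr x phi eal eh al0 (erefl : h 0%N = 0) dal.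
have AE x : A x ^+ 2 = expR (2 * psum h x).
  have tw0 (b : R^nat) : twc b 0 = b by apply/funext => n; rewrite /twc mulr0 cos0 mulr1.
  have := modE x 0; rewrite !tw0 => <-.
  rewrite (_ : psum (tws al 0) x = 0) ?expr0n ?addr0//.
  apply: lim_near_cst => //; apply: nearW => n.
  by rewrite /pseries /series/= big1// => i _; rewrite /tws mulr0 sin0 mulr0 mul0r.
have h1 n : n != 1%N -> h n = 0.
  apply: ridge_rigidity => //.
    by move=> m om; exact: log_coef_even.
  move=> rho phi rho0.
  rewrite -(ler_pM2l (_ : 0 < 2))// -ler_expR -modE -AE.
  (* At radius [sqrt rho] and angle [phi / 2], the squared real part is [rho (1 + cos phi) / 2];
     taking logarithms of the modulus bound gives the ridge hypothesis on [h]. *)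
  have := expR_psum_bound (Num.sqrt rho) (phi / 2).
  rewrite exprMn sqr_sqrtr// (_ : (phi / 2) *+ 2 = phi); last first.
    by rewrite -mulr_natr; field.
  suff -> : cos (phi / 2) ^+ 2 = (1 + cos phi) / 2 by [].
  have {2}-> : phi = (phi / 2) *+ 2 by rewrite -mulr_natr; field.
  by rewrite cos_mulr2n; field.
have hE : h 1%N = \int[P]_w (Y w ^+ 2) / 2.
  rewrite /h /log_coef /log_diffs /conv big_ord_recl big_ord0 addr0 /=.
  rewrite /altn subn0 al0 expr0 /pseries_diffs /al /even_moment /F /mom /moment.
  by rewrite (_ : 1.*2 = 2%N)// (_ : 2`! = 2%N)//; field.
move=> t; have Mpos : 0 <= M t by apply: Rintegral_ge0 => w _; exact: expR_ge0.
(* [AE] expresses only the square of [A] as an exponential; the sign of [M] permits taking roots. *)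
apply/eqP; rewrite -(@eqrXn2 _ 2)// ?expR_ge0//; apply/eqP.
rewrite -expRM_natl MA AE psum_linear// hE; congr expR; ring.
Qed.

End GaussianCharacterization.

(** * Uniqueness of the law *)

Section SignIteration.
Variable R : realType.
Implicit Types x y : R.

(** The Newton-Schulz iteration for the sign: it fixes -1, 0 and 1 and maps [[-1, 1]] into
    itself. *)
Definition sgstep : {poly R} := (3 / 2) *: 'X - 2^-1 *: 'X^3.

Definition sgpoly n : {poly R} := iter n (fun q => sgstep \Po q) 'X.

Lemma sgpoly0 x : (sgpoly 0).[x] = x.
Proof. by rewrite hornerX. Qed.

Lemma sgpolyS n x : (sgpoly n.+1).[x] =
  3 / 2 * (sgpoly n).[x] - 2^-1 * (sgpoly n).[x] ^+ 3.
Proof. by rewrite [sgpoly _]iterS horner_comp !hornerE. Qed.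

Lemma sgpolyN n x : (sgpoly n).[- x] = - (sgpoly n).[x].
Proof.
elim: n => [|n IHn]; first by rewrite !sgpoly0.
by rewrite !sgpolyS IHn; ring.
Qed.

(** One step multiplies [1 - y] by [1 - (y + y^2) / 2], which is at most [1 - x / 2] because the
    iterates stay above [x]. *)
Lemma sgpoly_pos n x : 0 <= x <= 1 ->
  x <= (sgpoly n).[x] <= 1 /\ 1 - (sgpoly n).[x] <= (1 - x / 2) ^+ n.
Proof.
move=> /andP[x0 x1]; elim: n => [|n [/andP[IH1 IH2] IH3]].
  by rewrite sgpoly0 lexx x1 expr0; split => //; lra.
rewrite sgpolyS; set y := (sgpoly n).[x] in IH1 IH2 IH3 *.
have E : 1 - (3 / 2 * y - 2^-1 * y ^+ 3) = (1 - y) * (1 - (y + y ^+ 2) / 2) by field.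
have y2 : y ^+ 2 <= 1 by rewrite expr_le1//; lra.
have y20 : 0 <= y ^+ 2 by rewrite sqr_ge0.
have y1 : 0 <= 1 - y by lra.
have c0 : 0 <= 1 - (y + y ^+ 2) / 2 by lra.
split.
  have p1 : 0 <= (1 - y) * (1 - (y + y ^+ 2) / 2) by rewrite mulr_ge0.
  have p2 : 0 <= y * (1 - y ^+ 2) by rewrite mulr_ge0//; lra.
  have -> : 3 / 2 * y - 2^-1 * y ^+ 3 = y + (y * (1 - y ^+ 2)) / 2 by field.
  rewrite -E in p1; apply/andP; split; first lra.
  have : 3 / 2 * y - 2^-1 * y ^+ 3 = y + (y * (1 - y ^+ 2)) / 2 by field.
  lra.
by rewrite E [leRHS]exprSr ler_pM//; lra.
Qed.

Lemma sgpoly_bound n x : `|x| <= 1 -> `|(sgpoly n).[x]| <= 1.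
Proof.
move=> x1; have [x0|x0] := leP 0 x.
  have [|/andP[a b] _] := @sgpoly_pos n x; first by rewrite x0 -(ger0_norm x0).
  by rewrite ger0_norm// (le_trans x0).
have Nx0 : 0 <= - x by rewrite oppr_ge0 ltW.
have [|/andP[]] := @sgpoly_pos n (- x); first by rewrite Nx0 -(ltr0_norm x0).
by rewrite sgpolyN => a b _; rewrite ler0_norm// -oppr_ge0 (le_trans Nx0).
Qed.

Lemma cvg_sgpoly x : `|x| <= 1 -> (fun n => (sgpoly n).[x]) @ \oo --> Num.sg x.
Proof.
have pos y : 0 < y -> y <= 1 -> (fun n => (sgpoly n).[y]) @ \oo --> (1 : R).
  move=> y0 y1; apply: cvg_sub0 (cvg_cst (1 : R)).
  apply: norm_cvg0; apply: (@squeeze_cvgr _ _ _ _ (cst 0)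
    (fun n => (1 - y / 2) ^+ n)); [|exact: cvg_cst|].
    apply: nearW => n /=; rewrite normr_ge0/=.
    have [|/andP[_ b] c] := @sgpoly_pos n y; first by rewrite ltW.
    by rewrite distrC ger0_norm// subr_ge0.
  by apply: cvg_expr; rewrite ger0_norm; lra.
move=> x1; case: (ltgtP x 0) => [x0|x0|->].
- rewrite ltr0_sg// (_ : (fun n => _) = (fun n => - (sgpoly n).[- x])).
    by apply: cvgN; apply: pos; [rewrite oppr_gt0|rewrite -ltr0_norm].
  by apply/funext => n; rewrite sgpolyN opprK.
- by rewrite gtr0_sg//; apply: pos => //; rewrite -(gtr0_norm x0).
- rewrite sgr0 (_ : (fun n => _) = cst 0); first exact: cvg_cst.
  apply/funext => n; elim: n => [|n IHn]; first by rewrite sgpoly0.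
  by rewrite sgpolyS IHn /=; ring.
Qed.

End SignIteration.

Section BoundedMeasurable.
Variable R : realType.
Implicit Types (f g : R -> R) (a b c : R).

Definition bounded_measurable f :=
  measurable_fun [set: R] f /\ exists C, forall x, `|f x| <= C.

Lemma bounded_measurableM f g : bounded_measurable f -> bounded_measurable g ->
  bounded_measurable (fun x => f x * g x).
Proof.
move=> [mf [C fC]] [mg [D gD]]; split; first exact: measurable_funM.
by exists (C * D) => x; rewrite normrM ler_pM.
Qed.

Lemma bounded_measurableD f g : bounded_measurable f -> bounded_measurable g ->
  bounded_measurable (fun x => f x + g x).
Proof.
move=> [mf [C fC]] [mg [D gD]]; split; first exact: measurable_funD.
by exists (C + D) => x; apply: le_trans (ler_normD _ _) _; rewrite lerD.
Qed.

Lemma bounded_measurable_cst k : bounded_measurable (fun=> k).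
Proof. by split; [exact: measurable_cst|exists `|k|]. Qed.

Lemma measurable_cosD a c : measurable_fun [set: R] (fun x : R => cos (a * x + c)).
Proof.
apply: (measurableT_comp (f := @cos R)).
  by apply: continuous_measurable_fun; exact: continuous_cos.
by apply: measurable_funD => //; exact: measurable_funM.
Qed.

Lemma bounded_measurable_cos a c : bounded_measurable (fun x => cos (a * x + c)).
Proof. by split; [exact: measurable_cosD|exists 1 => x; exact: cos_max]. Qed.

End BoundedMeasurable.

Section BoundedConvergence.
Context d (T : measurableType d) (R : realType) (P : probability T R).
Variable Y : T -> R.
Hypothesis mY : measurable_fun [set: T] Y.

Lemma integrable_bounded (f : R -> R) : bounded_measurable f ->
  P.-integrable [set: T] (EFin \o (fun w => f (Y w))).
Proof.
move=> [mf [C fC]].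
apply: (@le_integrable _ _ _ _ _ measurableT _ (cst C%:E)).
- by apply/measurable_EFinP; exact: measurableT_comp.
- by move=> w _; rewrite /= lee_fin (le_trans (fC _))// ler_norm.
- by apply: finite_measure_integrable_cst.
Qed.

Lemma bounded_convergence (f_ : nat -> R -> R) (f : R -> R) (C : R) :
  (forall n, measurable_fun [set: R] (f_ n)) -> measurable_fun [set: R] f ->
  (forall n x, `|f_ n x| <= C) -> (forall x, f_ ^~ x @ \oo --> f x) ->
  (fun n => \int[P]_w f_ n (Y w)) @ \oo --> \int[P]_w f (Y w).
Proof.
move=> mf_ mf fC fcv.
have fC' x : `|f x| <= C.
  have c : `|f_ n x| @[n --> \oo] --> `|f x| by apply: cvg_norm; exact: fcv.
  by rewrite -(cvg_lim _ c)//; apply: limr_le; [exact: (cvgP _ c)|apply: nearW => n; exact: fC].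
have ifY : P.-integrable [set: T] (EFin \o (fun w => f (Y w))).
  by apply: integrable_bounded; split => //; exists C.
have lim_ : {ae P, forall w, [set: T] w ->
    (f_ n (Y w))%:E @[n --> \oo] --> (f (Y w))%:E}.
  by apply: aeW => w _; apply: cvg_EFin; [exact: nearW|exact: fcv].
have idom : P.-integrable [set: T] (cst C%:E).
  exact: finite_measure_integrable_cst.
have dom : {ae P, forall w n, [set: T] w ->
    (`|(f_ n (Y w))%:E| <= cst C%:E w)%E}.
  by apply: aeW => w n _; rewrite /= lee_fin.
have [_ _ c1] := dominated_convergence measurableT
  (fun n => (measurable_EFinP _ _).2 (measurableT_comp (mf_ n) mY))
  ((measurable_EFinP _ _).2 (measurableT_comp mf mY)) lim_ idom dom.
apply: fine_cvg; rewrite fineK; first exact: c1.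
exact: integrable_fin_num.
Qed.

End BoundedConvergence.

(** * A law is determined by its trigonometric expectations *)

Section CharacteristicUniqueness.
Context d1 d2 (T1 : measurableType d1) (T2 : measurableType d2) (R : realType).
Variables (P : probability T1 R) (Q : probability T2 R).
Variables (Y : T1 -> R) (Z : T2 -> R).
Hypothesis mY : measurable_fun [set: T1] Y.
Hypothesis mZ : measurable_fun [set: T2] Z.
Hypothesis same_cos : forall a c : R,
  \int[P]_w cos (a * Y w + c) = \int[Q]_w cos (a * Z w + c).
Implicit Types (f g : R -> R) (a b c : R).

Let same f := \int[P]_w f (Y w) = \int[Q]_w f (Z w).

(* The tested class is that of the functions all of whose products with a cosine
   have the same expectation: by the product-to-sum formula it is stable under
   multiplication by cosines. *)
Let trig f := bounded_measurable f /\
  forall a c, same (fun x => f x * cos (a * x + c)).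

Lemma trig_cst k : trig (fun=> k).
Proof.
split; first exact: bounded_measurable_cst.
move=> a c; have bc := bounded_measurable_cos a c.
rewrite /same (RintegralZl _ measurableT (integrable_bounded P mY bc)).
by rewrite (RintegralZl _ measurableT (integrable_bounded Q mZ bc)) same_cos.
Qed.

Lemma same_linear f g x y : bounded_measurable f -> bounded_measurable g ->
  same f -> same g -> same (fun z => x * f z + y * g z).
Proof.
move=> bf bg sf sg; rewrite /same.
have bxf := bounded_measurableM (bounded_measurable_cst x) bf.
have byg := bounded_measurableM (bounded_measurable_cst y) bg.
rewrite (RintegralD measurableT (integrable_bounded P mY bxf)
  (integrable_bounded P mY byg)).
rewrite (RintegralD measurableT (integrable_bounded Q mZ bxf)
  (integrable_bounded Q mZ byg)).
rewrite (RintegralZl _ measurableT (integrable_bounded P mY bf)).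
rewrite (RintegralZl _ measurableT (integrable_bounded P mY bg)).
rewrite (RintegralZl _ measurableT (integrable_bounded Q mZ bf)).
by rewrite (RintegralZl _ measurableT (integrable_bounded Q mZ bg)) sf sg.
Qed.

Lemma trigD f g : trig f -> trig g -> trig (fun x => f x + g x).
Proof.
move=> [bf sf] [bg sg]; split; first exact: bounded_measurableD.
move=> a c; have bc := bounded_measurable_cos a c.
have := same_linear 1 1 (bounded_measurableM bf bc) (bounded_measurableM bg bc)
  (sf a c) (sg a c).
rewrite (_ : (fun z => _) = (fun x => (f x + g x) * cos (a * x + c)))//.
by apply/funext => x; ring.
Qed.

Lemma trigM_cos f a c : trig f -> trig (fun x => f x * cos (a * x + c)).
Proof.
move=> [bf sf]; split.
  exact: bounded_measurableM bf (bounded_measurable_cos a c).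
move=> b e.
have b1 := bounded_measurable_cos (a + b) (c + e).
have b2 := bounded_measurable_cos (a - b) (c - e).
have := same_linear 2^-1 2^-1 (bounded_measurableM bf b1) (bounded_measurableM bf b2)
  (sf _ _) (sf _ _).
rewrite (_ : (fun z => _) =
  (fun x => f x * cos (a * x + c) * cos (b * x + e)))//.
apply/funext => x.
have -> : (a + b) * x + (c + e) = (a * x + c) + (b * x + e) by ring.
have -> : (a - b) * x + (c - e) = (a * x + c) - (b * x + e) by ring.
by rewrite cosD cosB; field.
Qed.

Lemma trig_poly (q : {poly R}) a c : trig (fun x => q.[cos (a * x + c)]).
Proof.
elim/poly_ind: q => [|q k IHq].
  by under eq_fun do rewrite horner0; exact: trig_cst.
under eq_fun do rewrite hornerMXaddC.
by apply: trigD; [exact: trigM_cos|exact: trig_cst].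
Qed.

Lemma trig_same f : trig f -> same f.
Proof.
move=> [_ /(_ 0 0)]; rewrite (_ : (fun x => _) = f)//.
by apply/funext => x; rewrite mul0r add0r cos0 mulr1.
Qed.

Lemma same_lim (f_ : nat -> R -> R) f C :
  (forall n, measurable_fun [set: R] (f_ n)) -> measurable_fun [set: R] f ->
  (forall n x, `|f_ n x| <= C) -> (forall x, f_ ^~ x @ \oo --> f x) ->
  (forall n, same (f_ n)) -> same f.
Proof.
move=> mf_ mf fC fcv sf.
have cP := bounded_convergence (P := P) mY mf_ mf fC fcv.
have cQ := bounded_convergence (P := Q) mZ mf_ mf fC fcv.
have E : (fun n => \int[P]_w f_ n (Y w)) = (fun n => \int[Q]_w f_ n (Z w)).
  by apply/funext => n; exact: sf.
rewrite E in cP.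
exact: (cvg_unique _ cP cQ).
Qed.

Lemma measurable_sg : measurable_fun [set: R] (@Num.sg R).
Proof.
rewrite (_ : @Num.sg R = (fun x => \1_(`]0, +oo[) x - \1_(`]-oo, 0[) x)).
  by apply: measurable_funB; exact: measurable_indic.
apply/funext => x; rewrite !indicE !mem_setE !in_itv/= andbT.
case: (ltgtP x 0) => [x0|x0|->] /=; last by rewrite sgr0 subrr.
  by rewrite ltr0_sg// sub0r.
by rewrite gtr0_sg// subr0.
Qed.

Lemma norm_sg (x : R) : `|Num.sg x| <= 1.
Proof. by rewrite normr_sg; case: (x != 0). Qed.

Lemma same_sg_sin a b : same (fun x => Num.sg (sin (a * (x - b)))).
Proof.
have E x : sin (a * (x - b)) = cos (a * x + (- a * b - pi / 2)).
  by rewrite -cosBpihalf; congr cos; ring.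
apply: (@same_lim (fun n x => (sgpoly R n).[sin (a * (x - b))]) _ 1).
- move=> n; under eq_fun do rewrite E.
  by have [[]] := trig_poly (sgpoly R n) a (- a * b - pi / 2).
- apply: (measurableT_comp measurable_sg).
  by under eq_fun do rewrite E; exact: measurable_cosD.
- by move=> n x; apply: sgpoly_bound; exact: sin_max.
- by move=> x; apply: cvg_sgpoly; exact: sin_max.
- move=> n; under eq_fun do rewrite E.
  exact/trig_same/trig_poly.
Qed.

Lemma same_sg b : same (fun x => Num.sg (x - b)).
Proof.
apply: (@same_lim (fun n x => Num.sg (sin (n.+1%:R^-1 * (x - b)))) _ 1).
- move=> n; apply: (measurableT_comp measurable_sg).
  apply: (measurableT_comp (f := @sin R)).
    by apply: continuous_measurable_fun; exact: continuous_sin.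
  by apply: measurable_funM => //; exact: measurable_funB.
- apply: (measurableT_comp measurable_sg); exact: measurable_funB.
- by move=> n x; exact: norm_sg.
- move=> x; apply: cvg_near_cst; near=> n.
  have n0 : (0 : R) < n.+1%:R by rewrite ltr0n.
  (* Once [n > |x - b|] the argument lies in []-pi, pi[], where the sine has the sign of its
     argument. *)
  have small : `|n.+1%:R^-1 * (x - b)| < pi.
    rewrite normrM ger0_norm ?invr_ge0// mulrC ltr_pdivrMr//.
    apply: (@lt_le_trans _ _ n.+1%:R); last first.
      by rewrite ler_peMl ?ltW//; have := @pi_ge2 R; lra.
    rewrite (@lt_trans _ _ n%:R) ?ltr_nat//.
    by near: n; exact: nbhs_infty_gtr.
  have sgsin y : 0 < y < pi -> Num.sg (sin y) = 1 :> R.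
    by move=> /sin_gt0_pi/gtr0_sg.
  rewrite ltr_norml in small; case/andP: small => s1 s2.
  have i0 : (0 : R) < n.+1%:R^-1 by rewrite invr_gt0.
  case: (ltgtP x b) => [xb|xb|->]; last by rewrite subrr mulr0 sin0 !sgr0.
    rewrite (@ltr0_sg _ (x - b)) ?subr_lt0//.
    rewrite -[n.+1%:R^-1 * (x - b)]opprK sinN sgrN sgsin// ltrNl s1 andbT.
    by rewrite oppr_gt0 pmulr_rlt0// subr_lt0.
  by rewrite (@gtr0_sg _ (x - b)) ?subr_gt0// sgsin// s2 andbT mulr_gt0// subr_gt0.
- by move=> n; exact: same_sg_sin.
Unshelve. all: by end_near. Qed.

(** Centring the sign at [b + 1 / (n + 1)] gives the limit -1 at [x = b] too, removing the value 0
    of the sign there. *)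
Lemma same_ray b : same (fun x => 2 * \1_(`]b, +oo[) x - 1).
Proof.
apply: (@same_lim (fun n x => Num.sg (x - (b + n.+1%:R^-1))) _ 1).
- by move=> n; apply: (measurableT_comp measurable_sg); exact: measurable_funB.
- apply: measurable_funB => //; exact: measurable_funM.
- by move=> n x; exact: norm_sg.
- move=> x; apply: cvg_near_cst; rewrite indicE mem_setE in_itv/= andbT.
  have [bx|xb] := ltP b x; last first.
    apply: nearW => n; rewrite ltr0_sg ?mulr0 ?sub0r// subr_lt0.
    by rewrite (le_lt_trans xb)// ltrDl.
  have xb0 : 0 < x - b by rewrite subr_gt0.
  apply: filterS (near_infty_natSinv_lt (PosNum xb0)) => n /= xbn.
  rewrite gtr0_sg; first by rewrite mulr1; lra.
  by rewrite subr_gt0 -ltrBrDl.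
- by move=> n; exact: same_sg.
Qed.

Lemma same_ray_prob b :
  P (Y @^-1` `]b, +oo[%classic) = Q (Z @^-1` `]b, +oo[%classic).
Proof.
have E d (T : measurableType d) (m : probability T R) (W : T -> R) :
    measurable_fun [set: T] W ->
    \int[m]_w (2 * \1_(`]b, +oo[) (W w) - 1) =
    2 * fine (m (W @^-1` `]b, +oo[%classic)) - 1.
  move=> mW.
  have mA : measurable (W @^-1` `]b, +oo[%classic).
    by rewrite -[X in measurable X]setTI; exact: mW.
  have bi : bounded_measurable (fun x : R => \1_(`]b, +oo[) x).
    split; first exact: measurable_indic.
    by exists 1 => x; rewrite indicE; case: (_ \in _); rewrite ?normr1 ?normr0.
  have i1 := integrable_bounded m mW bi.
  have i2 := integrable_bounded m mW
    (bounded_measurableM (bounded_measurable_cst 2) bi).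
  rewrite (RintegralB measurableT i2); last first.
    exact: (integrable_bounded m mW (bounded_measurable_cst 1)).
  rewrite (RintegralZl _ measurableT i1) Rintegral_cst//= probability_setT mulr1.
  congr (2 * _ - 1).
  rewrite /Rintegral; congr fine.
  rewrite (eq_integral (fun w => (\1_(W @^-1` `]b, +oo[%classic) w)%:E)) => [|w _].
    by rewrite integral_indic// setIT.
  by rewrite !indicE.
have := same_ray b; rewrite /same !E// => /(addIr _) /(mulfI (lt0r_neq0 _)).
have fin d (T : measurableType d) (m : probability T R) (W : T -> R) :
    measurable_fun [set: T] W -> m (W @^-1` `]b, +oo[%classic) \is a fin_num.
  move=> mW; apply: fin_num_measure.
  by rewrite -[X in measurable X]setTI; exact: mW.
move=> /(_ (ltr0Sn R 1)) PQ.
by rewrite -(fineK (fin _ _ P _ mY)) -(fineK (fin _ _ Q _ mZ)) PQ.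
Qed.

(** Open right rays are stable under intersection, generate the Borel sets and exhaust the line, so
    agreement on them suffices. *)
Lemma same_law (A : set R) : measurable A -> P (Y @^-1` A) = Q (Z @^-1` A).
Proof.
pose Y' : {mfun T1 >-> R} := HB.pack Y (isMeasurableFun.Build _ _ _ _ Y mY).
pose Z' : {mfun T2 >-> R} := HB.pack Z (isMeasurableFun.Build _ _ _ _ Z mZ).
move=> mA; suff : distribution P Y' A = distribution Q Z' A by [].
apply: (measure_unique (@RGenOInfty.G R) (fun k => `](- k%:R), +oo[%classic)) => //.
- exact: RGenOInfty.measurableE.
- move=> _ _ [x ->] [y ->]; exists (Num.max x y); apply/seteqP; split=> z /=.
    by rewrite !in_itv/= !andbT gt_max => -[-> ->].
  by rewrite !in_itv/= !andbT gt_max => /andP[].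
- by move=> k; exists (- k%:R).
- rewrite -subTset => x _ /=.
  exists (Num.trunc `|x|).+1 => //=.
  rewrite in_itv/= andbT ltrNl.
  apply: le_lt_trans (truncnS_gt _).
  by rewrite -normrN ler_norm.
- by move=> _ [x ->]; exact: same_ray_prob.
- by move=> k; rewrite ltey_eq fin_num_measure.
Qed.

End CharacteristicUniqueness.

(** * Gaussian laws *)

Section GaussianCosine.
Context d (T : measurableType d) (R : realType) (P : probability T R).
Variable Y : T -> R.
Hypothesis mY : measurable_fun [set: T] Y.
Hypothesis iY : forall t : R, P.-integrable [set: T] (fun w => (expR (t * Y w))%:E).

(** Analytic continuation from [t] to [i a], done on coefficients. Evenness of the moment generating
    function kills the odd moments, hence [E sin(a Y)]; comparing series in [t^2] fixes the even
    ones, hence [E cos(a Y)]. *)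
Lemma gaussian_cos (k : R) :
  (forall t, \int[P]_w expR (t * Y w) = expR (t ^+ 2 * k)) ->
  forall a c, \int[P]_w cos (a * Y w + c) = expR (- (a ^+ 2 * k)) * cos c.
Proof.
move=> M a c; pose F : R^nat := fun n => n`!%:R^-1.
have bF : fact_bounded F by move=> n; rewrite ger0_norm ?invr_ge0.
have em : entire (even_moment P Y) by exact: entire_even_moment.
have ek : entire (fun n => F n * k ^+ n) by apply/entire_dilate/entire_fact.
have memE : even_moment P Y = fun n => F n * k ^+ n.
  apply: psum_inj => // x x0; rewrite psum_dilate psum_fact.
  rewrite -(sqr_sqrtr (ltW x0)) -even_mgf// !M sqrrN mulrC.
  by rewrite [X in _ = expR X]mulrC; field.
have Ecos : \int[P]_w cos (a * Y w) = expR (- (a ^+ 2 * k)).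
  by rewrite cos_even_moment// memE psum_dilate psum_fact mulrN mulrC.
have modd n : odd n -> moment P Y n = 0.
  move=> on; pose b : R^nat := fun n => F n * moment P Y n.
  have eb : entire b by exact: entire_moment.
  have bE : b = altn b.
    apply: psum_inj => // [|x _]; first exact: entire_altn.
    by rewrite psum_altn -!mgfE// !M sqrrN.
  have := congr1 (fun u : R^nat => u n) bE; rewrite /altn -signr_odd on expr1 mulN1r => /eqP.
  rewrite -addr_eq0 -mulr2n mulrn_eq0/= mulf_eq0 invr_eq0 pnatr_eq0.
  by move=> /orP[|/eqP//]; rewrite gtn_eqF// fact_gt0.
have Esin : \int[P]_w sin (a * Y w) = 0.
  pose e : R^nat := fun n => (odd n)%:R * (-1) ^+ n.-1./2 * n`!%:R^-1.
  have be : fact_bounded e.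
    move=> n; rewrite /e normrM [X in _ * X]ger0_norm ?invr_ge0//.
    rewrite ler_piMl ?invr_ge0// normrM normrX normrN1 expr1n mulr1 normr_nat.
    by case: odd.
  rewrite sinE [LHS](Rintegral_psum mY iY a be).
  apply: lim_near_cst => //; apply: nearW => n.
  rewrite /pseries /series/= big1// => i _; rewrite /e.
  by have [/modd->|_] := boolP (odd i); rewrite ?mulr0 !mul0r.
have bc := bounded_measurable_cos a 0.
have bs : bounded_measurable (fun x => sin (a * x)).
  have E x : sin (a * x) = cos (a * x + - (pi / 2)) by rewrite cosBpihalf.
  by under eq_fun do rewrite E; exact: bounded_measurable_cos.
have bc' : bounded_measurable (fun x => cos (a * x)).
  by have := bc; under eq_fun do rewrite addr0.
have b1 := bounded_measurableM bc' (bounded_measurable_cst (cos c)).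
have b2 := bounded_measurableM bs (bounded_measurable_cst (sin c)).
under eq_Rintegral do rewrite cosD.
rewrite (RintegralB measurableT (integrable_bounded P mY b1)
  (integrable_bounded P mY b2)).
rewrite (RintegralZr _ measurableT (integrable_bounded P mY bc')).
rewrite (RintegralZr _ measurableT (integrable_bounded P mY bs)).
by rewrite Ecos Esin mul0r subr0.
Qed.

End GaussianCosine.

(** * Moment generating function of the normal law *)

Section NormalMoments.
Variable R : realType.
Local Notation mu := (@lebesgue_measure R).

(** The Radon-Nikodym derivative and the normal density have the same integral over every measurable
    set, hence agree almost everywhere. *)
Lemma ge0_integral_normal_prob (s : R) (f : R -> \bar R) :
  measurable_fun [set: R] f -> (forall x, 0 <= f x)%E ->
  (\int[normal_prob 0 s]_x f x = \int[mu]_x (f x * (normal_pdf 0 s x)%:E))%E.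
Proof.
move=> mf f0; have dom := @normal_prob_dominates R 0 s.
rewrite -(Radon_Nikodym_SigmaFinite.change_of_variables dom)//.
have ig := Radon_Nikodym_SigmaFinite.f_integrable dom.
apply: ae_eq_integral => //.
- by apply: emeasurable_funM => //; exact: measurable_int ig.
- by apply: emeasurable_funM => //; apply/measurable_EFinP; exact: measurable_normal_pdf.
- apply: ae_eqe_mul2l; apply: integral_ae_eq => //.
    by apply/measurable_EFinP; exact: measurable_normal_pdf.
  by move=> E _ mE; rewrite -Radon_Nikodym_SigmaFinite.f_integral.
Qed.

Lemma mgf_normal_prob (s t : R) : s != 0 ->
  (\int[normal_prob 0 s]_x (expR (t * x))%:E = (expR (t ^+ 2 * (s ^+ 2 / 2)))%:E)%E.
Proof.
move=> s0; rewrite ge0_integral_normal_prob; last 2 first.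
- apply/measurable_EFinP/measurableT_comp => //; exact: measurable_funM.
- by move=> x; rewrite lee_fin expR_ge0.
(* Completing the square: the exponential tilt shifts the mean to [t s^2], and the shifted density
   integrates to 1. *)
have E x : ((expR (t * x))%:E * (normal_pdf 0 s x)%:E =
    (expR (t ^+ 2 * (s ^+ 2 / 2)))%:E * (normal_pdf (t * s ^+ 2) s x)%:E)%E.
  rewrite -!EFinM !normal_pdfE// mulrCA [in RHS]mulrCA; congr (_ * _)%:E.
  rewrite /normal_fun -!expRD; congr expR; field.
  by rewrite s0.
under eq_integral do rewrite E.
rewrite ge0_integralZl//.
- by rewrite integral_normal_pdf mule1.
- by apply/measurable_EFinP; exact: measurable_normal_pdf.
- by move=> x _; rewrite lee_fin normal_pdf_ge0.
Qed.

(** [normal_law] is a bare set function; integrating against it takes a probability measure with the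
    same values, in the Dirac case as well. *)
Lemma normal_law_prob (v : R) : 0 <= v ->
  exists Q : probability (measurableTypeR R) R,
    (forall A, Q A = normal_law 0 v A) /\
    forall t, (\int[Q]_x (expR (t * x))%:E = (expR (t ^+ 2 * (v / 2)))%:E)%E.
Proof.
move=> v0; rewrite /normal_law; have [->|vN0] := eqVneq v 0.
  exists (dirac (0 : measurableTypeR R)); split=> // t.
  rewrite integral_dirac//.
    by rewrite diracT mul1e mulr0 mul0r mulr0.
  by apply/measurable_EFinP/measurableT_comp => //; exact: measurable_funM.
exists (normal_prob 0 (Num.sqrt v)); split=> // t.
rewrite mgf_normal_prob ?sqr_sqrtr//.
by rewrite gt_eqF// sqrtr_gt0 lt_neqAle eq_sym vN0.
Qed.

End NormalMoments.

(** * One-dimensional projections and second moments of the vector *)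

Section Projections.
Context (R : realType) (disp : measure_display) (T : measurableType disp)
  (P : probability T R) (d : nat) (X : T -> 'cV[R]_d).
Hypothesis X_rv : random_vector X.
Hypothesis X_mgf : forall t : 'cV[R]_d, (mgf P X t < +oo)%E.
Implicit Types (t a : 'cV[R]_d).

Lemma dotvE t (x : 'cV[R]_d) : dotv t x = \sum_i t i 0 * x i 0.
Proof. by rewrite /dotv mxE; apply: eq_bigr => i _; rewrite mxE. Qed.

Lemma dotvZl (s : R) t x : dotv (s *: t) x = s * dotv t x.
Proof.
by rewrite !dotvE mulr_sumr; apply: eq_bigr => i _; rewrite mxE mulrA.
Qed.

Lemma measurable_dotv t : measurable_fun [set: T] (fun w => dotv t (X w)).
Proof.
under eq_fun do rewrite dotvE.
apply: measurable_sum => i; apply: measurable_funM => //; exact: X_rv.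
Qed.

Lemma integrable_exp_dotv t (s : R) :
  P.-integrable [set: T] (fun w => (expR (s * dotv t (X w)))%:E).
Proof.
apply/integrableP; split.
  apply/measurable_EFinP; apply: measurableT_comp => //.
  by apply: measurable_funM => //; exact: measurable_dotv.
have := X_mgf (s *: t); rewrite /mgf unlock; apply: le_lt_trans.
rewrite le_eqVlt; apply/orP; left; apply/eqP; apply: eq_integral => w _ /=.
by rewrite ger0_norm ?expR_ge0// dotvZl.
Qed.

(** The factor 1 puts the integrand in the form [s * Y w] of the one-dimensional results, with
    [s = 1]. *)
Lemma mgf_Rintegral t : mgf P X t = (\int[P]_w expR (1 * dotv t (X w)))%:E.
Proof.
rewrite /mgf unlock /Rintegral fineK.
  by apply: eq_integral => w _; rewrite mul1r.
exact/integrable_fin_num/integrable_exp_dotv.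
Qed.

Lemma Re_char_fun t :
  complex.Re (char_fun P X t) = \int[P]_w cos (1 * dotv t (X w)).
Proof.
rewrite /char_fun /expectationC /= unlock /Rintegral; congr fine.
by apply: eq_integral => w _; rewrite mul1r.
Qed.

Lemma dotv_delta i (x : 'cV[R]_d) : dotv (delta_mx i 0) x = x i 0.
Proof.
rewrite dotvE (bigD1 i)//= mxE !eqxx mul1r big1 ?addr0// => j /negbTE ji.
by rewrite mxE ji mul0r.
Qed.

(** Coordinates are projections on basis vectors, so their squares are integrable, and
    [|x y| <= x^2 + y^2]. *)
Lemma integrable_coord_prod i j :
  P.-integrable [set: T] (EFin \o (fun w => X w i 0 * X w j 0)).
Proof.
have isq k : P.-integrable [set: T] (EFin \o (fun w => X w k 0 ^+ 2)).
  have := integrable_power (measurable_dotv (delta_mx k 0))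
    (integrable_exp_dotv (delta_mx k 0)) 2.
  by under eq_fun do rewrite dotv_delta.
apply: (@le_integrable _ _ _ _ _ measurableT _
  (EFin \o (fun w => X w i 0 ^+ 2 + X w j 0 ^+ 2))).
- by apply/measurable_EFinP; apply: measurable_funM; exact: X_rv.
- move=> w _; rewrite /= lee_fin [leRHS]ger0_norm ?addr_ge0 ?sqr_ge0//.
  set x := X w i 0; set y := X w j 0.
  have s1 := sqr_ge0 (x - y); have s2 := sqr_ge0 (x + y).
  have s3 := sqr_ge0 x; have s4 := sqr_ge0 y.
  by rewrite ler_norml; apply/andP; split; nra.
- exact: (integrableD measurableT (isq i) (isq j)).
Qed.

Lemma Rintegral_sum n (f : 'I_n -> T -> R) :
  (forall i, P.-integrable [set: T] (EFin \o f i)) ->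
  P.-integrable [set: T] (EFin \o (fun w => \sum_i f i w)) /\
  \int[P]_w (\sum_i f i w) = \sum_i \int[P]_w f i w.
Proof.
elim: n f => [|n IHn] f fi.
  split.
    rewrite (_ : _ \o _ = cst 0%E); first exact: integrable0.
    by apply/funext => w /=; rewrite big_ord0.
  under eq_Rintegral do rewrite big_ord0.
  by rewrite Rintegral_cst// mul0r big_ord0.
have [i1 E1] := IHn (fun i => f (lift ord0 i)) (fun i => fi _).
split.
  rewrite (_ : _ \o _ = (EFin \o f ord0) \+
      (EFin \o (fun w => \sum_i f (lift ord0 i) w))).
    exact: integrableD (fi ord0) i1.
  by apply/funext => w /=; rewrite big_ord_recl.
under eq_Rintegral do rewrite big_ord_recl.
by rewrite RintegralD// ?E1 ?big_ord_recl//; exact: fi.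
Qed.

(** For centred [X] this is the covariance matrix; it is the witness for [S]. *)
Definition second_moment : 'M[R]_d := \matrix_(i, j) \int[P]_w (X w i 0 * X w j 0).

Lemma second_moment_quad a :
  dotv a (second_moment *m a) = \int[P]_w (dotv a (X w) ^+ 2).
Proof.
have E w : dotv a (X w) ^+ 2 =
    \sum_i \sum_j a i 0 * a j 0 * (X w i 0 * X w j 0).
  rewrite dotvE expr2 mulr_suml; apply: eq_bigr => i _.
  by rewrite mulr_sumr; apply: eq_bigr => j _; ring.
have int i j : P.-integrable [set: T]
    (EFin \o (fun w => a i 0 * a j 0 * (X w i 0 * X w j 0))).
  rewrite (_ : _ \o _ = fun w =>
    ((a i 0 * a j 0)%:E * (EFin \o (fun w => X w i 0 * X w j 0)%R) w)%E).
    by apply: integrableZl => //; exact: integrable_coord_prod.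
  by apply/funext.
under eq_Rintegral do rewrite E.
rewrite (Rintegral_sum (fun i => (Rintegral_sum (int i)).1)).2.
rewrite dotvE; apply: eq_bigr => i _.
rewrite (Rintegral_sum (int i)).2 mxE mulr_sumr; apply: eq_bigr => j _.
rewrite RintegralZl//; last exact: integrable_coord_prod.
by rewrite mxE; ring.
Qed.

End Projections.

Lemma mul_sub1_eq0 (R : realType) (x y : R) :
  (x%:E * y%:E - 1 = 0)%E <-> x * y = 1.
Proof.
by split=> [[/eqP]|H]; [rewrite subr_eq0 => /eqP|rewrite -EFinM H -EFinB subrr].
Qed.

Theorem corollary2p2 (R : realType) (disp : measure_display)
    (T : measurableType disp) (P : probability T R) (d : nat)
    (X : T -> 'cV[R]_d)
    (X_rv : random_vector X)
    (X_nondeg : nondegenerate_rv P X)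
    (X_mgf : forall t : 'cV[R]_d, (mgf P X t < +oo)%E)
    (X_mean : forall i : 'I_d, ('E_P[fun w => X w i 0%R] = 0)%E) :
  (forall t : 'cV[R]_d,
     ((complex.Re (char_fun P X t))%:E * mgf P X t - 1 = 0)%E)
  <-> exists S : 'M[R]_d, mvnormal P X 0 S.
Proof.
have dot0 a : dotv a (0 : 'cV[R]_d) = 0.
  by rewrite dotvE big1// => i _; rewrite mxE mulr0.
have mY a := measurable_dotv X_rv a.
have iY a t := integrable_exp_dotv X_rv X_mgf a t.
split=> [H|[S [_ S0 lawS]] t].
  exists (second_moment P X); have quad a := second_moment_quad X_rv X_mgf a.
  have S0 a : 0 <= dotv a (second_moment P X *m a).
    by rewrite quad; apply: Rintegral_ge0 => w _; exact: sqr_ge0.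
  split=> //.
    apply/matrixP => i j; rewrite !mxE.
    by apply: eq_Rintegral => w _; rewrite mulrC.
  move=> a A mA; rewrite dot0.
  have [Q [QE Qexp]] := normal_law_prob (S0 a).
  (* The identity under [Q] is a variable with the target normal law, to be compared with
     [dotv a (X w)]. *)
  pose Z : measurableTypeR R -> R := idfun.
  have mZ : measurable_fun [set: measurableTypeR R] Z by exact: measurable_id.
  have iZ s : Q.-integrable [set: measurableTypeR R] (fun x => (expR (s * Z x))%:E).
    apply/integrableP; split.
      by apply/measurable_EFinP/measurableT_comp => //; exact: measurable_funM.
    under eq_integral do rewrite /= ger0_norm ?expR_ge0//.
    by rewrite Qexp ltry.
  have M s : \int[P]_w expR (s * dotv a (X w)) =
      expR (s ^+ 2 * (dotv a (second_moment P X *m a) / 2)).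
    rewrite quad; apply: exp_cos_gaussian => // t.
    (* Restricting the identity to the line spanned by [a] gives the one-dimensional identity for
       the projection. *)
    have := H (t *: a); rewrite mgf_Rintegral// Re_char_fun => /mul_sub1_eq0 <-.
    by congr (_ * _); apply: eq_Rintegral => w _; rewrite dotvZl mul1r.
  have Qint s : \int[Q]_x expR (s * Z x) =
      expR (s ^+ 2 * (dotv a (second_moment P X *m a) / 2)).
    by rewrite /Rintegral Qexp.
  (* Equal Gaussian moment generating functions give equal cosine expectations, hence equal laws. *)
  rewrite -QE; apply: (same_law (mY a) mZ _ mA) => b c.
  by rewrite [LHS](gaussian_cos (mY a) (iY a) M) [RHS](gaussian_cos mZ iZ Qint).
(* Conversely, normality of the projection on [t] gives its moment generating function; then [E cos]
   and [E exp] at [t] are [exp(-k)] and [exp(k)] with [k] half the variance. *)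
have [Q [QE Qexp]] := normal_law_prob (S0 t).
have mYt : measurable_fun (U := measurableTypeR R) [set: T]
  (fun w => dotv t (X w)) by exact: mY.
pose Y : {mfun T >-> measurableTypeR R} :=
  HB.pack ((fun w => dotv t (X w)) : T -> measurableTypeR R)
    (isMeasurableFun.Build _ _ _ _ _ mYt).
have M s : \int[P]_w expR (s * dotv t (X w)) =
    expR (s ^+ 2 * (dotv t (S *m t) / 2)).
  rewrite -[RHS]/(fine (_%:E)) -Qexp; congr fine.
  transitivity (\int[distribution P Y]_x (expR (s * x))%:E)%E.
    rewrite ge0_integral_distribution//.
    by apply/measurable_EFinP/measurableT_comp => //; exact: measurable_funM.
  apply: (@eq_measure_integral _ (measurableTypeR R) R setT Q (distribution P Y)).
  by move=> A mA _; rewrite [RHS]QE -(dot0 t); exact: lawS.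
rewrite mgf_Rintegral// Re_char_fun; apply/mul_sub1_eq0.
have := gaussian_cos (mY t) (iY t) M 1 0.
under eq_Rintegral do rewrite addr0.
by move=> ->; rewrite M cos0 mulr1 -expRD addNr expR0.
Qed.
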